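(* Let $p$ be an odd prime, $a\in\mathbb Z_p$ with $a\not\equiv 0,-1\pmod p$, and $a'=(a-\langle a\rangle_p)/p$. Then $$\sum_{k=0}^{p-1}\binom ak\binom{-1-a}k\binom{2k}k\frac1{4^k(k+1)}+\frac{a'(a'+1)}{a(a+1)}p^2\equiv\sum_{k=0}^{p-2}\binom ak\binom{-1-a}k\binom{2k}k\frac1{4^k(k+1)}\equiv S_p(a)+\frac{a+1}aS_p(a+1)\pmod{p^3}.$$ Thus, writing $m=\langle a\rangle_p$: (1) for $2\mid m$, $$\sum_{k=0}^{p-2}\binom ak\binom{-1-a}k\binom{2k}k\frac1{4^k(k+1)}\equiv\binom{(p-1)/2}{m/2}^2\Big(1+p\big((2a'+2)H_m-(2a'+1)H_{m/2}-2a'q_p(2)\big)+\frac{p^2}2\Big(2a'q_p(2)^2+\big((2a'+2)H_m-(2a'+1)H_{m/2}-2a'q_p(2)\big)^2+\frac12(2a'^2-1)H^{(2)}_{m/2}+2(1-a'^2)H^{(2)}_m\Big)\Big)+p^2\frac{a'(a'+1)}{a(a+1)}\binom{(p-1)/2}{m/2}^{-2}\pmod{p^3};$$ (2) for $2\nmid m$ and $m\ne p-2$, $$\sum_{k=0}^{p-2}\binom ak\binom{-1-a}k\binom{2k}k\frac1{4^k(k+1)}\equiv\frac{a+1}a\binom{(p-1)/2}{(m+1)/2}^2\Big(1+p\big((2a'+2)H_{m+1}-(2a'+1)H_{(m+1)/2}-2a'q_p(2)\big)+\frac{p^2}2\Big(2a'q_p(2)^2+\big((2a'+2)H_{m+1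}-(2a'+1)H_{(m+1)/2}-2a'q_p(2)\big)^2+\frac12(2a'^2-1)H^{(2)}_{(m+1)/2}+2(1-a'^2)H^{(2)}_{m+1}\Big)\Big)+p^2\frac{a'(a'+1)}{(a+1)^2}\binom{(p-1)/2}{(m+1)/2}^{-2}\pmod{p^3}.$$
   Context: For a prime $p$, $\mathbb Z_p$ denotes the set of rational numbers whose denominator is not divisible by $p$, and congruences modulo powers of $p$ are between elements of $\mathbb Z_p$ (the difference divided by that power of $p$ lies in $\mathbb Z_p$). For $a\in\mathbb Z_p$, $\langle a\rangle_p\in\{0,1,\ldots,p-1\}$ is determined by $a\equiv\langle a\rangle_p\pmod p$. For rational $a$ and integer $k\ge0$, $\binom ak=a(a-1)\cdots(a-k+1)/k!$. Define $S_n(a)=\sum_{k=0}^{n-1}\binom ak\binom{-1-a}k\binom{2k}k\frac1{4^k}$ for $n\ge1$. Also $q_p(2)=(2^{p-1}-1)/p$, $H_n=\sum_{k=1}^n\frac1k$, $H_n^{(2)}=\sum_{k=1}^n\frac1{k^2}$, $H_0=H_0^{(2)}=0$. *)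

(* Defs.v *)
From HB Require Import structures.
From mathcomp Require Import all_boot all_order all_algebra.
From mathcomp Require Import ring zify.

Set Implicit Arguments.
Unset Strict Implicit.
Unset Printing Implicit Defensive.

Import Order.TTheory GRing.Theory Num.Theory.
Local Open Scope ring_scope.

Definition Zp_loc (p : nat) : pred rat := [pred x | ~~ (p %| `|denq x|)%N].

(* Congruence modulo p ^ n, between elements of Zp_loc p. *)
Definition eqZp (p n : nat) (x y : rat) : bool :=
  [&& x \in Zp_loc p, y \in Zp_loc p & (x - y) / p%:R ^+ n \in Zp_loc p].

(* The first m in 0, ..., p - 1 congruent to a modulo p (and p if there is
   none); see residueP and residue_uniq. *)
Definition residue (p : nat) (a : rat) : nat :=
  find (fun m => eqZp p 1 a m%:R) (iota 0 p).

Definition binq (a : rat) (k : nat) : rat :=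
  (\prod_(i < k) (a - i%:R)) / k`!%:R.

Definition summand (a : rat) (k : nat) : rat :=
  binq a k * binq (-1 - a) k * ('C(k.*2, k))%:R / 4%:R ^+ k.

Definition Ssum (n : nat) (a : rat) : rat := \sum_(0 <= k < n) summand a k.

Definition fermat_quot2 (p : nat) : rat := (2%:R ^+ p.-1 - 1) / p%:R.

Definition harm (n : nat) : rat := \sum_(1 <= k < n.+1) k%:R^-1.

Definition harm2 (n : nat) : rat := \sum_(1 <= k < n.+1) (k%:R ^+ 2)^-1.

Lemma Zp_locP (p : nat) (x : rat) :
  reflect (exists u : int, exists2 v : nat,
             ~~ (p %| v)%N & x = u%:~R / v%:R) (x \in Zp_loc p).
Proof.
apply: (iffP idP) => [xZ | [u [v pv ->]]].
  exists (numq x), `|denq x|%N => //.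
  by rewrite -[LHS]divq_num_den -{1}[denq x]gez0_abs ?denq_ge0.
have v0 : v%:Z != 0 by apply: contraNneq pv => -[->]; rewrite dvdn0.
rewrite -[v%:R]/(v%:Z%:~R); move: v0 pv; rewrite -{2}[v]/(`|v%:Z|%N).
case: (divqP u v%:Z) => [|k x' k0 v0 pv]; first by rewrite eqxx.
apply: contra pv => /= pd; rewrite abszM.
by apply: dvdn_mull.
Qed.

Lemma residueP (p : nat) (a : rat) : prime p -> a \in Zp_loc p ->
  (residue p a < p)%N && eqZp p 1 a (residue p a)%:R.
Proof.
move=> pp aZ.
have hasm : has (fun m => eqZp p 1 a m%:R) (iota 0 p).
  have p0 := prime_gt0 pp.
  have [u [v pv aE]] := Zp_locP p a aZ.
  have cop : coprimez v p.
    by rewrite coprimezE /= coprime_sym prime_coprime.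
  have [[r s] /= rs] := coprimezP _ _ cop.
  have v0 : v%:R != 0 :> rat.
    by rewrite pnatr_eq0; apply: contraNneq pv => ->; rewrite dvdn0.
  pose m := (u * r %% p)%Z.
  have m0 : 0 <= m by rewrite modz_ge0 //; lia.
  have mp : m < p by apply: ltz_pmod; lia.
  apply/hasP; exists `|m|%N; first by rewrite mem_iota; lia.
  apply/and3P; split => //.
    apply/Zp_locP; exists `|m|%N%:Z, 1%N; last by rewrite divr1.
    by rewrite dvdn1; case: eqP pp => // ->.
  apply/Zp_locP.
  exists (u * s + (u * r %/ p)%Z * v), v => //.
  have mE : `|m|%N%:R = m%:~R :> rat by rewrite -[in RHS](gez0_abs m0).
  have pR : p%:R != 0 :> rat by rewrite pnatr_eq0 -lt0n.
  rewrite mE aE expr1.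
  have dE : m%:~R = u%:~R * r%:~R - (u * r %/ p)%Z%:~R * p%:R :> rat.
    have := congr1 (fun z : int => z%:~R : rat) (divz_eq (u * r) p).
    rewrite intrD !intrM => ->; rewrite -/m; ring.
  have bE : r%:~R * v%:R + s%:~R * p%:R = 1 :> rat.
    by have := congr1 (fun z : int => z%:~R : rat) rs; rewrite intrD !intrM.
  have uE : u%:~R = u%:~R * (r%:~R * v%:R + s%:~R * p%:R) :> rat.
    by rewrite bE mulr1.
  rewrite dE intrD !intrM {1}uE -[v%:~R]/(v%:R).
  by field; rewrite v0 pR.
have := nth_find 0%N hasm; move: hasm; rewrite has_find size_iota => lt.
by rewrite nth_iota // add0n /residue lt.
Qed.

Lemma residue_uniq (p m : nat) (a : rat) : prime p -> (m < p)%N ->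
  eqZp p 1 a m%:R -> m = residue p a.
Proof.
move=> pp mp am.
have aZ : a \in Zp_loc p by case/and3P: am.
have /andP[rp ar] := residueP pp aZ.
set r := residue p a in rp ar *.
have /and3P[_ _ /Zp_locP[u [v pv E1]]] := am.
have /and3P[_ _ /Zp_locP[u' [v' pv' E2]]] := ar.
have nz (w : nat) : ~~ (p %| w)%N -> w%:R != 0 :> rat.
  by move=> h; rewrite pnatr_eq0; apply: contraNneq h => ->; rewrite dvdn0.
have pR : p%:R != 0 :> rat by rewrite pnatr_eq0 -lt0n prime_gt0.
have v0 := nz _ pv; have v0' := nz _ pv'.
have E : (r%:Z - m%:Z) * (v * v')%N%:Z = p%:Z * (u * v' - u' * v) :> int.
  apply: (@intr_inj rat); rewrite !(intrM, intrB, PoszM).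
  have -> : r%:Z%:~R - m%:Z%:~R = p%:R * (u%:~R / v%:R - u'%:~R / v'%:R) :> rat.
    by rewrite -E1 -E2 !expr1; field.
  by field; rewrite v0 v0'.
have : (p %| absz ((r%:Z - m%:Z) * (v * v')%N%:Z)%R)%N.
  by rewrite E abszM dvdn_mulr.
rewrite abszM Euclid_dvdM // Euclid_dvdM // (negPf pv) (negPf pv') !orbF.
move/dvdn_leq => h.
by case: (posnP (absz (r%:Z - m%:Z)%R)) => [|/h]; lia.
Qed.

(* Main.v *)
(** Write a = p x + m with 0 <= m < p, h = (p - 1) / 2, and S for [Ssum p].
    Telescoping gives (b + 2)^2 S(b + 2) - (b + 1)^2 S(b) in closed form; the
    closed form is divisible by p^3 unless b is congruent to -1 or -2, and it
    contributes p^2 x when b = p x - 1.  A second telescoping sum expresses the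
    weighted sum through S(a) and S(a + 1), up to a multiple of [summand a p],
    which is known modulo p from C(p x + m, p) = x (mod p).  Stepping down by 2,
    everything reduces to S(p x) (m even), and to S(p x + 1) = p^2 x (x + 1)
    (m odd).  Modulo p^3, S(p x) = 1 + p A x + p^2 B x^2 with A, B independent
    of x, so two values suffice: the vanishing of the full sum at odd integers
    gives S(p) = C(2p, p)^2 / 4^p = 4^(1-p), and the recurrence from -p up to -1
    gives S(-p) = prod_(j <= h) (1 - p / (2 j))^2 = 4^(p-1).  The products
    arising from the recurrence are expanded as truncated exponentials, which
    multiply modulo p^3 by adding exponents. *)

Require Import Defs.
From mathcomp Require Import all_boot all_order all_algebra.
From mathcomp Require Import cyclic.
From mathcomp Require Import ring zify.

Set Implicit Arguments.
Unset Strict Implicit.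
Unset Printing Implicit Defensive.

Import Order.TTheory GRing.Theory Num.Theory.
Local Open Scope ring_scope.

(** * Localization at a prime *)

(** The units of the localization. The condition [x != 0] matters because [0^-1 = 0]: without it 0
    would pass both membership tests. *)
Definition punit (p : nat) : pred rat :=
  [pred x | [&& x != 0, x \in Zp_loc p & x^-1 \in Zp_loc p]].

Section Localization.

Variable p : nat.
Hypothesis p_prime : prime p.

Let p0 : p%:R != 0 :> rat.
Proof. by rewrite pnatr_eq0 -lt0n prime_gt0. Qed.

Let ndvd_neq0 (v : nat) : ~~ (p %| v)%N -> v%:R != 0 :> rat.
Proof. by move=> h; rewrite pnatr_eq0; apply: contraNneq h => ->; rewrite dvdn0. Qed.

Lemma Zp_intr (u : int) : u%:~R \in Zp_loc p.
Proof.
apply/Zp_locP; exists u, 1%N; last by rewrite divr1.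
by rewrite dvdn1 neq_ltn prime_gt1 ?orbT.
Qed.

Lemma Zp_natr (k : nat) : k%:R \in Zp_loc p.
Proof. exact: (Zp_intr k%:Z). Qed.

Lemma ZpN (x : rat) : x \in Zp_loc p -> - x \in Zp_loc p.
Proof.
move=> /Zp_locP[u [v pv ->]]; apply/Zp_locP; exists (- u), v => //.
by rewrite intrN mulNr.
Qed.

Lemma ZpD (x y : rat) :
  x \in Zp_loc p -> y \in Zp_loc p -> x + y \in Zp_loc p.
Proof.
move=> /Zp_locP[u [v pv ->]] /Zp_locP[u' [v' pv' ->]].
apply/Zp_locP; exists (u * v'%:Z + u' * v%:Z), (v * v')%N.
  by rewrite Euclid_dvdM // negb_or pv.
by rewrite intrD !intrM natrM; field; rewrite !ndvd_neq0.
Qed.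

Lemma ZpM (x y : rat) :
  x \in Zp_loc p -> y \in Zp_loc p -> x * y \in Zp_loc p.
Proof.
move=> /Zp_locP[u [v pv ->]] /Zp_locP[u' [v' pv' ->]].
apply/Zp_locP; exists (u * u'), (v * v')%N.
  by rewrite Euclid_dvdM // negb_or pv.
by rewrite !intrM natrM; field; rewrite !ndvd_neq0.
Qed.

Lemma ZpX (x : rat) (k : nat) : x \in Zp_loc p -> x ^+ k \in Zp_loc p.
Proof.
move=> xZ; elim: k => [|k IH]; first exact: (Zp_natr 1).
by rewrite exprS ZpM.
Qed.

Lemma Zp_sum (I : Type) (r : seq I) (P : pred I) (F : I -> rat) :
  (forall i, P i -> F i \in Zp_loc p) ->
  \sum_(i <- r | P i) F i \in Zp_loc p.
Proof.
move=> h; apply: (big_ind (fun x => x \in Zp_loc p)) => //.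
  exact: (Zp_natr 0).
exact: ZpD.
Qed.

Lemma Zp_prod (I : Type) (r : seq I) (P : pred I) (F : I -> rat) :
  (forall i, P i -> F i \in Zp_loc p) ->
  \prod_(i <- r | P i) F i \in Zp_loc p.
Proof.
move=> h; apply: (big_ind (fun x => x \in Zp_loc p)) => //.
  exact: (Zp_natr 1).
exact: ZpM.
Qed.

Lemma punit_neq0 (x : rat) : punit p x -> x != 0.
Proof. by case/and3P. Qed.

Lemma punit_Zp (x : rat) : punit p x -> x \in Zp_loc p.
Proof. by case/and3P. Qed.

Lemma punitV_Zp (x : rat) : punit p x -> x^-1 \in Zp_loc p.
Proof. by case/and3P. Qed.

Lemma punitM (x y : rat) : punit p x -> punit p y -> punit p (x * y).
Proof.
move=> /and3P[x0 x1 x2] /and3P[y0 y1 y2].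
by apply/and3P; rewrite mulf_neq0 // invfM !ZpM.
Qed.

Lemma punitV (x : rat) : punit p x -> punit p x^-1.
Proof. by move=> /and3P[x0 x1 x2]; apply/and3P; rewrite invr_eq0 invrK. Qed.

Lemma punitX (x : rat) (k : nat) : punit p x -> punit p (x ^+ k).
Proof.
move=> /and3P[x0 x1 x2]; apply/and3P.
by rewrite -exprVn !ZpX // expf_neq0.
Qed.

Lemma punit_int (u : int) : ~~ (p %| `|u|)%N -> punit p u%:~R.
Proof.
move=> pu; have u0 : u != 0 by apply: contraNneq pu => ->; rewrite dvdn0.
apply/and3P; split; rewrite ?intr_eq0 ?Zp_intr //.
case: u pu {u0} => n pn.
  by apply/Zp_locP; exists 1, n; rewrite ?div1r.
apply/Zp_locP; exists (-1), n.+1 => //.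
by rewrite NegzE mulrNz invrN mulN1r.
Qed.

Lemma punit_nat (k : nat) : ~~ (p %| k)%N -> punit p k%:R.
Proof. exact: (@punit_int k%:Z). Qed.

Lemma punit_small (k : nat) : (0 < k < p)%N -> punit p k%:R.
Proof. by move=> /andP[k0 kp]; apply: punit_nat; rewrite gtnNdvd. Qed.

Lemma punit_fact (k : nat) : (k < p)%N -> punit p k`!%:R.
Proof.
elim: k => [|k IH] kp; first by apply: (@punit_small 1); rewrite prime_gt1.
by rewrite factS natrM punitM ?IH ?(ltnW kp) // punit_small.
Qed.

Lemma eqZpP (n : nat) (x y : rat) :
  reflect (y \in Zp_loc p /\ exists2 z, z \in Zp_loc p & x = y + p%:R ^+ n * z)
          (eqZp p n x y).
Proof.
have pn0 : p%:R ^+ n != 0 :> rat by rewrite expf_neq0.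
apply: (iffP idP) => [/and3P[xZ yZ zZ]|[yZ [z zZ ->]]].
  by split=> //; exists ((x - y) / p%:R ^+ n) => //; field.
apply/and3P; split=> //.
  by rewrite ZpD // ZpM // ZpX // Zp_natr.
suff -> : (y + p%:R ^+ n * z - y) / p%:R ^+ n = z by [].
by field.
Qed.

Lemma eqZp_refl (n : nat) (x : rat) : x \in Zp_loc p -> eqZp p n x x.
Proof.
by move=> xZ; apply/and3P; split; rewrite ?subrr ?mul0r ?(Zp_natr 0).
Qed.

Lemma eqZp_l (n : nat) (x y : rat) : eqZp p n x y -> x \in Zp_loc p.
Proof. by case/and3P. Qed.

Lemma eqZp_sym (n : nat) (x y : rat) : eqZp p n x y -> eqZp p n y x.
Proof.
move=> /and3P[xZ yZ h]; apply/and3P; split=> //.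
by rewrite -opprB mulNr ZpN.
Qed.

Lemma eqZp_trans (n : nat) (y x z : rat) :
  eqZp p n x y -> eqZp p n y z -> eqZp p n x z.
Proof.
move=> /and3P[xZ _ h] /and3P[_ zZ h']; apply/and3P; split=> //.
have -> : x - z = (x - y) + (y - z) by ring.
by rewrite mulrDl ZpD.
Qed.

Lemma eqZpN (n : nat) (x y : rat) : eqZp p n x y -> eqZp p n (- x) (- y).
Proof.
move=> /and3P[xZ yZ h]; apply/and3P; split; rewrite ?ZpN //.
by rewrite -opprD mulNr ZpN.
Qed.

Lemma eqZpD (n : nat) (x y x' y' : rat) :
  eqZp p n x y -> eqZp p n x' y' -> eqZp p n (x + x') (y + y').
Proof.
move=> /and3P[xZ yZ h] /and3P[xZ' yZ' h']; apply/and3P; split; rewrite ?ZpD //.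
have -> : x + x' - (y + y') = (x - y) + (x' - y') by ring.
by rewrite mulrDl ZpD.
Qed.

Lemma eqZpM (n : nat) (x y x' y' : rat) :
  eqZp p n x y -> eqZp p n x' y' -> eqZp p n (x * x') (y * y').
Proof.
move=> /and3P[xZ yZ h] /and3P[xZ' yZ' h']; apply/and3P.
split; [exact: ZpM | exact: ZpM |].
have -> : (x * x' - y * y') / p%:R ^+ n =
    x * ((x' - y') / p%:R ^+ n) + (x - y) / p%:R ^+ n * y' by ring.
by rewrite ZpD // ZpM.
Qed.

Lemma eqZpMl (n : nat) (z x y : rat) :
  z \in Zp_loc p -> eqZp p n x y -> eqZp p n (z * x) (z * y).
Proof. by move=> zZ h; apply: eqZpM => //; apply: eqZp_refl. Qed.

Lemma eqZpMr (n : nat) (z x y : rat) :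
  z \in Zp_loc p -> eqZp p n x y -> eqZp p n (x * z) (y * z).
Proof. by move=> zZ h; apply: eqZpM => //; apply: eqZp_refl. Qed.

Lemma eqZpX (n k : nat) (x y : rat) :
  eqZp p n x y -> eqZp p n (x ^+ k) (y ^+ k).
Proof.
move=> h; elim: k => [|k IH]; first exact/eqZp_refl/(Zp_natr 1).
by rewrite !exprS eqZpM.
Qed.

Lemma eqZp_prod (n : nat) (I : Type) (r : seq I) (P : pred I) (F G : I -> rat) :
  (forall i, P i -> eqZp p n (F i) (G i)) ->
  eqZp p n (\prod_(i <- r | P i) F i) (\prod_(i <- r | P i) G i).
Proof.
move=> h; apply: (big_ind2 (eqZp p n)) => //; first exact/eqZp_refl/(Zp_natr 1).
by move=> *; apply: eqZpM.
Qed.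

Lemma eqZp_sum (n : nat) (I : Type) (r : seq I) (P : pred I) (F G : I -> rat) :
  (forall i, P i -> eqZp p n (F i) (G i)) ->
  eqZp p n (\sum_(i <- r | P i) F i) (\sum_(i <- r | P i) G i).
Proof.
move=> h; apply: (big_ind2 (eqZp p n)) => //; first exact/eqZp_refl/(Zp_natr 0).
by move=> *; apply: eqZpD.
Qed.

(** Serves to clear denominators: both sides are multiplied by a unit and the fractions simplified
    before the congruence is proved. *)
Lemma eqZp_mulIl (n : nat) (w x y : rat) :
  punit p w -> eqZp p n (w * x) (w * y) -> eqZp p n x y.
Proof.
move=> hw; have w0 := punit_neq0 hw.
by move/(eqZpMl (punitV_Zp hw)); rewrite !mulKf.
Qed.

Lemma eqZp_pmul (k n : nat) (x y : rat) :
  eqZp p n x y -> eqZp p (k + n) (p%:R ^+ k * x) (p%:R ^+ k * y).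
Proof.
move=> /eqZpP[yZ [z zZ ->]]; apply/eqZpP; split.
  by rewrite ZpM // ZpX // Zp_natr.
by exists z => //; rewrite exprD; ring.
Qed.

Lemma eqZp_le (n k : nat) (x y : rat) :
  (k <= n)%N -> eqZp p n x y -> eqZp p k x y.
Proof.
move=> kn /eqZpP[yZ [z zZ ->]]; apply/eqZpP; split=> //.
exists (p%:R ^+ (n - k) * z); first by rewrite ZpM // ZpX // Zp_natr.
by rewrite mulrA -exprD subnKC.
Qed.

Lemma eqZp_padd (n : nat) (x y z : rat) : y \in Zp_loc p -> z \in Zp_loc p ->
  x = y + p%:R ^+ n * z -> eqZp p n x y.
Proof. by move=> *; apply/eqZpP; split=> //; exists z. Qed.

(** With z / y = s / t and t prime to p, x = y + p z equals y (t + p s) / t, and t + p s is prime to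
    p. *)
Lemma punit_eqZp (x y : rat) : eqZp p 1 x y -> punit p y -> punit p x.
Proof.
move=> /eqZpP[yZ [z zZ ->]] yu; have y0 := punit_neq0 yu.
have /Zp_locP[s [t pt zE]] := ZpM zZ (punitV_Zp yu).
have t0 := ndvd_neq0 pt.
have -> : y + p%:R ^+ 1 * z = y * ((t%:Z + p%:Z * s)%:~R / t%:R).
  have -> : z = (s%:~R / t%:R) * y by rewrite -zE divfK.
  by rewrite intrD intrM expr1; field.
apply: punitM => //; apply: punitM; last exact/punitV/punit_nat.
apply: punit_int; apply: contra pt => pd.
have : (p%:Z %| t%:Z + p%:Z * s)%Z by [].
by rewrite rpredDr // dvdz_mulr.
Qed.

Lemma punit_neqZp0 (x : rat) : x \in Zp_loc p -> ~~ eqZp p 1 x 0 -> punit p x.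
Proof.
move=> /Zp_locP[u [v pv ->]] h; have v0 := ndvd_neq0 pv.
apply: punitM; last exact/punitV/punit_nat.
apply: punit_int; apply: contra h => pd.
have /dvdzP[k ->] : (p%:Z %| u)%Z by [].
apply: (@eqZp_padd _ _ _ (k%:~R / v%:R)); first exact: (Zp_natr 0).
  by rewrite ZpM ?Zp_intr // punitV_Zp // punit_nat.
by rewrite add0r intrM expr1; ring.
Qed.

Lemma eqZpV (n : nat) (x y : rat) :
  punit p x -> punit p y -> eqZp p n x y -> eqZp p n x^-1 y^-1.
Proof.
move=> xu yu h; have x0 := punit_neq0 xu; have y0 := punit_neq0 yu.
apply: (eqZp_mulIl (punitM xu yu)).
have -> : x * y * x^-1 = y by field.
have -> : x * y * y^-1 = x by field.
exact: eqZp_sym.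
Qed.

End Localization.

(** Descends through the ring structure of the expression; what remains, typically inverses, is
    looked up among the hypotheses or left as a goal. *)
Ltac zp :=
  match goal with h : is_true (prime _) |- _ =>
  lazymatch goal with
  | |- is_true (@in_mem _ (@GRing.mul _ _ _) _) => refine (ZpM h _ _); zp
  | |- is_true (@in_mem _ (@GRing.exp _ _ _) _) => refine (ZpX h _ _); zp
  | |- is_true (@in_mem _ (@GRing.one _) _) => exact (Zp_natr h 1)
  | |- is_true (@in_mem _ (@Algebra.natmul _ (@GRing.one _) _) _) =>
      exact (Zp_natr h _)
  | |- is_true (@in_mem _ (@Algebra.add _ _ _) _) => refine (ZpD h _ _); zp
  | |- is_true (@in_mem _ (@Algebra.opp _ _) _) => refine (ZpN _); zp
  | |- is_true (@in_mem _ (@Algebra.zero _) _) => exact (Zp_natr h 0)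
  | |- is_true (@in_mem _ (@bigop _ _ _ _ _) _) =>
      first [apply: (Zp_prod h) => ? _; zp | apply: (Zp_sum h) => ? _; zp]
  | |- is_true (@in_mem _ ?x _) =>
      try match goal with
      k : is_true (@in_mem _ ?y _) |- _ => constr_eq x y; exact k
      end
  | |- _ => try assumption
  end
  end.

Ltac nat_lia := repeat match goal with
  | h : is_true (punit _ _) |- _ => clear h
  | h : is_true (eqZp _ _ _ _) |- _ => clear h
  | h : is_true (~~ eqZp _ _ _ _) |- _ => clear h
  | h : is_true (@in_mem _ _ _) |- _ => clear h
  | h : is_true (@negb (@eq_op ?T _ _)) |- _ => unify (Equality.sort T) rat; clear h
  | h : @eq ?T _ _ |- _ => unify T rat; clear h
  end; lia.

(** * Telescoping identities *)

(** The falling factorial, the numerator of [binq]. *)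
Definition ffq (a : rat) (k : nat) : rat := \prod_(i < k) (a - i%:R).

Definition cbin (k : nat) : rat := ('C(k.*2, k))%:R / 4%:R ^+ k.

Lemma ffqSr (a : rat) (k : nat) : ffq a k.+1 = ffq a k * (a - k%:R).
Proof. by rewrite /ffq big_ord_recr. Qed.

Lemma ffqSl (a : rat) (k : nat) : ffq a k.+1 = a * ffq (a - 1) k.
Proof.
rewrite /ffq big_ord_recl subr0; congr (_ * _); apply: eq_bigr => i _.
by rewrite lift0 -natr1; ring.
Qed.

Lemma ffq_add (a : rat) (j k : nat) :
  ffq a (j + k) = ffq a j * ffq (a - j%:R) k.
Proof.
elim: k => [|k IH]; first by rewrite addn0 /ffq big_ord0 mulr1.
by rewrite addnS !ffqSr IH natrD; ring.
Qed.

(** Pulling the sign out of each factor -1 - a - i leaves (a + 1) ... (a + k), the falling factorial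
    from a + k. *)
Lemma ffq_reflect (a : rat) (k : nat) :
  ffq (-1 - a) k = (-1) ^+ k * ffq (a + k%:R) k.
Proof.
elim: k a => [|k IH] a; first by rewrite /ffq !big_ord0 mulr1.
rewrite ffqSr IH ffqSl exprS.
have -> : a + k.+1%:R - 1 = a + k%:R by rewrite -addn1 natrD; ring.
by rewrite -addn1 natrD; ring.
Qed.

Lemma fact_neq0 (k : nat) : k`!%:R != 0 :> rat.
Proof. by rewrite pnatr_eq0 -lt0n fact_gt0. Qed.

Lemma cbin0 : cbin 0 = 1. Proof. by []. Qed.

Lemma cbinS (k : nat) : cbin k.+1 = cbin k * (2 * k%:R + 1) / (2 * k%:R + 2).
Proof.
have cE j : ('C(j.*2, j))%:R = (j.*2)`!%:R / (j`!%:R * j`!%:R) :> rat.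
  have jj : (j <= j.*2)%N by rewrite -addnn leq_addr.
  have := congr1 (fun z => z%:R : rat) (bin_fact jj).
  rewrite /= -addnn addnK !natrM addnn => <-.
  by rewrite mulfK // mulf_neq0 ?fact_neq0.
rewrite /cbin !cE doubleS !factS !natrM exprS.
have k1 : k%:R + 1 != 0 :> rat by rewrite natr1 pnatr_eq0.
have -> : k.*2.+2%:R = 2 * (k%:R + 1) :> rat by rewrite -!natr1 -muln2 natrM; ring.
have -> : k.*2.+1%:R = 2 * k%:R + 1 :> rat by rewrite -!natr1 -muln2 natrM; ring.
have -> : k.+1%:R = k%:R + 1 :> rat by rewrite natr1.
have f4 : 4%:R ^+ k != 0 :> rat by rewrite expf_neq0.
have h2 : 2 * k%:R + 2 != 0 :> rat.
  by rewrite (_ : _ + _ = 2 * (k%:R + 1)) ?mulf_neq0 //; ring.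
by field; rewrite k1 f4 h2 fact_neq0.
Qed.

Lemma summand_cbin (a : rat) (k : nat) :
  summand a k = binq a k * binq (-1 - a) k * cbin k.
Proof. by rewrite /summand /cbin; ring. Qed.

(** The ratio of consecutive terms. It is later read backwards, to get the term at p - 1 from the
    term at p. *)
Lemma summandS (a : rat) (k : nat) : summand a k.+1 =
  - summand a k * (a - k%:R) * (a + k%:R + 1) * (2 * k%:R + 1)
    / (2 * k.+1%:R ^+ 3).
Proof.
rewrite !summand_cbin /binq -!/(ffq _ _) !ffqSr !factS !natrM cbinS -natr1.
have k1 : k%:R + 1 != 0 :> rat by rewrite natr1 pnatr_eq0.
have k2 : 2 * k%:R + 2 != 0 :> rat.
  by rewrite (_ : _ + _ = 2 * (k%:R + 1)) ?mulf_neq0 //; ring.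
by field; rewrite k1 k2 fact_neq0.
Qed.

(** By reflection the two binomials merge into one run of 2k consecutive factors (a + k) ... (a - k
    + 1), so shifting a or k only adds or removes factors at the ends. *)
Lemma summandE (a : rat) (k : nat) :
  summand a k = (-1) ^+ k * ffq (a + k%:R) (k + k) / k`!%:R ^+ 2 * cbin k.
Proof.
rewrite ffq_add addrK /summand /binq -/(ffq a k) -/(ffq (-1 - a) k).
rewrite ffq_reflect /cbin; field.
by rewrite fact_neq0 expf_neq0.
Qed.

Lemma summand0 (a : rat) : summand a 0 = 1.
Proof. by rewrite summandE /ffq big_ord0 cbin0. Qed.

Lemma SsumS (n : nat) (a : rat) : Ssum n.+1 a = Ssum n a + summand a n.
Proof. by rewrite /Ssum big_nat_recr. Qed.

Lemma Ssum1 (a : rat) : Ssum 1 a = 1.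
Proof. by rewrite /Ssum big_nat1 summand0. Qed.

Lemma summand_sym (a : rat) (k : nat) : summand (-1 - a) k = summand a k.
Proof.
rewrite /summand (_ : -1 - (-1 - a) = a) ?[binq a k * _]mulrC //; ring.
Qed.

(** The substitution exchanges the two binomials. It reduces the value at -1 to the one at 0, and
    the value at p x - 1 to the one at - p x. *)
Lemma Ssum_sym (n : nat) (a : rat) : Ssum n (-1 - a) = Ssum n a.
Proof. by apply: eq_bigr => k _; apply: summand_sym. Qed.

(* The right-hand side is the usual hypergeometric certificate, written with a
   falling factorial so that it has no denominators [a + 1 - k], [a + 2 - k],
   which vanish for small natural numbers [a]. *)
Lemma Ssum_step2 (n : nat) (a : rat) :
  (a + 2) ^+ 2 * Ssum n.+1 (a + 2) - (a + 1) ^+ 2 * Ssum n.+1 a =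
  (4 * a + 6) * (-1) ^+ n * n.+1%:R * ffq (a + n.+1%:R) (n + n)
    / n`!%:R ^+ 2 * cbin n.+1.
Proof.
elim: n => [|n IH].
  by rewrite !Ssum1 cbinS cbin0 /ffq big_ord0 fact0; field.
rewrite SsumS [Ssum n.+2 a]SsumS.
have -> (x y z t u v : rat) : u * (x + y) - v * (z + t) =
  (u * x - v * z) + (u * y - v * t) by ring.
rewrite IH !summandE ![cbin n.+2]cbinS !factS !natrM.
rewrite (_ : (n.+1 + n.+1 = (n + n).+2)%N); last by rewrite addnS.
(* All three falling factorials contain the run [V] = (a + n + 1) ... (a - n + 2); factoring it out
   leaves a polynomial identity. *)
set V := ffq (a + n.+1%:R) (n + n).
have -> : ffq (a + 2 + n.+1%:R) (n + n).+2 =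
    (a + n%:R + 3) * (a + n%:R + 2) * V.
  rewrite 2!ffqSl /V (_ : a + 2 + n.+1%:R - 1 - 1 = a + n.+1%:R); last by ring.
  by rewrite -natr1; ring.
have -> : ffq (a + n.+1%:R) (n + n).+2 = V * (a - n%:R + 1) * (a - n%:R).
  by rewrite 2!ffqSr -/V -!natr1 natrD; ring.
have -> : ffq (a + n.+2%:R) (n + n).+2 = (a + n%:R + 2) * V * (a - n%:R + 1).
  rewrite ffqSl (_ : a + n.+2%:R - 1 = a + n.+1%:R); last by rewrite -!natr1; ring.
  by rewrite ffqSr -/V -!natr1 natrD; ring.
rewrite -!natr1 !exprS.
have n1 : n%:R + 1 != 0 :> rat by rewrite natr1 pnatr_eq0.
have n2 : 2 * (n%:R + 1) + 2 != 0 :> rat.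
  by rewrite (_ : _ + _ = 2 * n.+2%:R) ?mulf_neq0 ?pnatr_eq0 // -!natr1; ring.
by field; rewrite n1 n2 fact_neq0.
Qed.

(** A second telescoping certificate: both sides have the same increment in n. Multiplying by [a]
    avoids a denominator; at n = p - 1 the right-hand side is a multiple of [summand a p]. *)
Lemma sum_summand_div (n : nat) (a : rat) :
  a * (\sum_(0 <= k < n.+1) summand a k / k.+1%:R) - a * Ssum n.+1 a
    - (a + 1) * Ssum n.+1 (a + 1) =
  - 2 * (-1) ^+ n * ffq (a + n.+1%:R) (n + n).+1 / n`!%:R ^+ 2 * cbin n.+1.
Proof.
elim: n => [|n IH].
  by rewrite !Ssum1 big_nat1 summand0 cbinS cbin0 ffqSl /ffq big_ord0 fact0; field.
rewrite big_nat_recr // SsumS [Ssum n.+2 (a + 1)]SsumS /=.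
have -> (S x y z s t u v : rat) : u * (S + s) - u * (x + y) - v * (z + t) =
  (u * S - u * x - v * z) + (u * s - u * y - v * t) by ring.
rewrite IH !summandE ![cbin n.+2]cbinS !factS !natrM.
rewrite (_ : (n.+1 + n.+1 = (n + n).+2)%N); last by rewrite addnS.
set V := ffq (a + n.+1%:R) (n + n).+1.
have -> : ffq (a + 1 + n.+1%:R) (n + n).+2 = (a + n%:R + 2) * V.
  rewrite ffqSl (_ : a + 1 + n.+1%:R - 1 = a + n.+1%:R); last by ring.
  by rewrite -/V -natr1; ring.
have -> : ffq (a + n.+1%:R) (n + n).+2 = V * (a - n%:R).
  by rewrite ffqSr -/V -!natr1 natrD; ring.
have -> : ffq (a + n.+2%:R) (n + n).+3 = (a + n%:R + 2) * V * (a - n%:R).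
  rewrite ffqSl (_ : a + n.+2%:R - 1 = a + n.+1%:R); last by rewrite -!natr1; ring.
  by rewrite ffqSr -/V -!natr1 natrD; ring.
rewrite -!natr1 !exprS.
have n1 : n%:R + 1 != 0 :> rat by rewrite natr1 pnatr_eq0.
have n1' : n%:R + 1 + 1 != 0 :> rat by rewrite !natr1 pnatr_eq0.
have n2 : 2 * (n%:R + 1) + 2 != 0 :> rat.
  by rewrite (_ : _ + _ = 2 * n.+2%:R) ?mulf_neq0 ?pnatr_eq0 // -!natr1; ring.
by field; rewrite n1 n1' n2 fact_neq0.
Qed.

Lemma ffq_nat0 (N k : nat) : (N < k)%N -> ffq N%:R k = 0.
Proof.
move=> Nk; rewrite /ffq (bigD1 (Ordinal Nk)) //= subrr mul0r //.
Qed.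

(** The closed form in [Ssum_step2] contains a falling factorial of a natural number that runs past
    0, so it vanishes. The chain starts at a = -1, where the coefficient (a + 1)^2 removes the other
    sum. *)
Lemma Ssum_odd_nat (n j : nat) : (j.*2 < n)%N -> Ssum n.+1 (j.*2.+1)%:R = 0.
Proof.
elim: j => [|j IH] jn.
  have := Ssum_step2 n (-1).
  rewrite (_ : -1 + 2 = 1%:R :> rat) // (_ : -1 + n.+1%:R = n%:R :> rat).
    by rewrite ffq_nat0; [rewrite ?(addNr, mulr0, mul0r) expr1n mul1r subr0|lia].
  by rewrite -natr1; ring.
have := Ssum_step2 n (j.*2.+1)%:R.
have -> : j.*2.+1%:R + 2 = (j.+1).*2.+1%:R :> rat by rewrite doubleS -natrD addn2.
rewrite IH; last by rewrite doubleS in jn; lia.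
rewrite -natrD ffq_nat0; last by rewrite doubleS in jn; lia.
rewrite !(mulr0, mul0r) subr0 => /eqP; rewrite mulf_eq0 expf_eq0 /= pnatr_eq0 /=.
by move/eqP.
Qed.

Lemma ffq_nat (N k : nat) : ffq N%:R k = (N ^_ k)%:R.
Proof.
elim: k => [|k IH]; first by rewrite /ffq big_ord0 ffactn0.
rewrite ffqSr IH ffactnSr natrM; case: (leqP k N) => kN; first by rewrite natrB.
by rewrite ffact_small // !mul0r.
Qed.

Lemma ffq_fact (k : nat) : ffq k%:R k = k`!%:R.
Proof. by rewrite ffq_nat ffactnn. Qed.

Lemma binq_nat (N k : nat) : binq N%:R k = ('C(N, k))%:R.
Proof.
rewrite /binq -/(ffq _ _) ffq_nat -bin_ffact natrM mulfK //.
exact: fact_neq0.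
Qed.

Lemma big_ord_double (R : Type) (idx : R) (op : Monoid.law idx) (h : nat)
    (F : nat -> R) :
  \big[op/idx]_(i < h.*2) F i =
  \big[op/idx]_(i < h) op (F i.*2) (F i.*2.+1).
Proof.
elim: h => [|h IH]; first by rewrite !big_ord0.
by rewrite doubleS !big_ord_recr /= IH -Monoid.mulmA.
Qed.

Lemma ffqN1 (m : nat) : ffq (-1) m = (-1) ^+ m * m`!%:R.
Proof. by rewrite -{1}[-1]subr0 ffq_reflect add0r ffq_fact. Qed.

Lemma fact_sqr_prod (m : nat) :
  m`!%:R ^+ 2 = \prod_(i < m) (-1 - i%:R) ^+ 2 :> rat.
Proof.
by rewrite prodrXl -/(ffq (-1) m) ffqN1 exprMn sqrr_sign mul1r.
Qed.

Lemma fact_prod_ord (n : nat) : n`!%:R = \prod_(j < n) j.+1%:R :> rat.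
Proof.
elim: n => [|n IH]; first by rewrite big_ord0.
by rewrite factS natrM big_ord_recr /= IH mulrC.
Qed.

Lemma Ssum_zero (n : nat) : Ssum n.+1 0 = 1.
Proof.
elim: n => [|n IH]; first exact: Ssum1.
by rewrite SsumS IH /summand /binq -!/(ffq _ _) ffqSl !mul0r addr0.
Qed.

(* [exp (p u + p ^ 2 v / 2)] up to terms of order 3 in [p]. *)
Definition texp (p : nat) (u v : rat) : rat :=
  1 + p%:R * u + p%:R ^+ 2 / 2 * (u ^+ 2 + v).

(** * Congruences modulo powers of p *)

Lemma primeR_neq0 (p : nat) : prime p -> p%:R != 0 :> rat.
Proof. by move=> pp; rewrite pnatr_eq0 -lt0n prime_gt0. Qed.

Lemma prime_fact_pred (p : nat) :
  prime p -> p`!%:R = p%:R * p.-1`!%:R :> rat.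
Proof. by move=> /prime_gt0; case: p => // n _; rewrite factS natrM. Qed.

Lemma odd_predE (n : nat) : odd n -> n.-1 = n.-1./2.*2.
Proof. by have := odd_double_half n.-1; case: n => //= n; lia. Qed.

Section Congruences.

Variable p : nat.
Hypothesis p_prime : prime p.
Hypothesis p_odd : odd p.

Let h := p.-1./2.
Let q := fermat_quot2 p.
Let w : rat := 2 ^+ p.-1.

Let p0 : p%:R != 0 :> rat := primeR_neq0 p_prime.
Let p2 : (2 < p)%N := odd_prime_gt2 p_odd p_prime.
Let p1E : p.-1 = h.*2 := odd_predE p_odd.
Let pfact : p`!%:R = p%:R * p.-1`!%:R :> rat := prime_fact_pred p_prime.

Let p_pred : p%:R = p.-1%:R + 1 :> rat.
Proof. by rewrite natr1 prednK // prime_gt0. Qed.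

Let pE : p%:R = 2 * h%:R + 1 :> rat.
Proof. by rewrite p_pred p1E -muln2 natrM mulrC. Qed.

Lemma punit2 : punit p 2.
Proof. by apply: (punit_small p_prime). Qed.

Lemma punit1 : punit p 1.
Proof. by apply: (punit_small p_prime (k := 1)); rewrite prime_gt1. Qed.

Lemma eqZp1_padd (y z : rat) : y \in Zp_loc p -> z \in Zp_loc p ->
  eqZp p 1 (p%:R * z + y) y.
Proof.
by move=> *; apply: (eqZp_padd p_prime (z := z)) => //; rewrite addrC expr1.
Qed.

(** * Binomial coefficients and summands modulo p *)

Lemma ffq_eqZp (n k : nat) (a b : rat) :
  eqZp p n a b -> eqZp p n (ffq a k) (ffq b k).
Proof.
move=> ab; apply: eqZp_prod => // i _; apply: eqZpD => //.
by apply: eqZp_refl => //; zp.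
Qed.

Lemma ffq_Zp (k : nat) (a : rat) : a \in Zp_loc p -> ffq a k \in Zp_loc p.
Proof. by move=> aZ; rewrite /ffq; zp. Qed.

Lemma cbin_Zp (k : nat) : cbin k \in Zp_loc p.
Proof.
rewrite /cbin; zp; apply: punitV_Zp; apply: punitX => //.
by rewrite (natrM _ 2 2); apply: punitM => //; apply: punit2.
Qed.

Lemma punit_fact_pred : punit p p.-1`!%:R.
Proof. by apply: punit_fact => //; rewrite prednK // prime_gt0. Qed.

Lemma sign_pred : (-1) ^+ p.-1 = 1 :> rat.
Proof. by rewrite -signr_odd -subn1 oddB ?prime_gt0 // p_odd. Qed.

Lemma ffqN1_pred (x : rat) : x \in Zp_loc p ->
  eqZp p 1 (ffq (p%:R * x - 1) p.-1) p.-1`!%:R.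
Proof.
move=> xZ.
have -> : p.-1`!%:R = ffq (-1) p.-1.
  by rewrite -{1}[-1]subr0 ffq_reflect sign_pred add0r mul1r ffq_fact.
by apply: ffq_eqZp; apply: eqZp1_padd => //; zp.
Qed.

(** For r = 0, C(p x, p) is x times (p x - 1) ... (p x - p + 1) / (p - 1)!, a quotient congruent to
    1. The step uses (b + 1 - p) C(b + 1, p) = (b + 1) C(b, p), whose outer factors are congruent
    units as long as r + 1 < p. *)
Lemma binq_p_mod (x : rat) (r : nat) : x \in Zp_loc p -> (r < p)%N ->
  eqZp p 1 (binq (p%:R * x + r%:R) p) x.
Proof.
move=> xZ; have fu := punit_fact_pred; have f0 := punit_neq0 fu.
elim: r => [|r IH] rp.
  rewrite addr0 /binq -/(ffq _ _).
  have -> : ffq (p%:R * x) p = p%:R * x * ffq (p%:R * x - 1) p.-1.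
    by rewrite -ffqSl prednK // prime_gt0.
  rewrite pfact.
  have -> : p%:R * x * ffq (p%:R * x - 1) p.-1 / (p%:R * p.-1`!%:R) =
     x * (ffq (p%:R * x - 1) p.-1 * (p.-1`!%:R)^-1) by field; rewrite p0 f0.
  rewrite -{3}[x]mulr1; apply: eqZpMl => //.
  rewrite -[X in eqZp _ _ _ X](mulfV f0); apply: eqZpMr => //.
    exact: punitV_Zp.
  exact: ffqN1_pred.
set b := p%:R * x + r%:R.
have -> : p%:R * x + r.+1%:R = b + 1 by rewrite /b -natr1; ring.
have bu : punit p (b + 1 - p%:R).
  apply: (@punit_eqZp _ p_prime _ r.+1%:R); last by apply: punit_small.
  have -> : b + 1 - p%:R = p%:R * (x - 1) + r.+1%:R by rewrite /b -natr1; ring.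
  by apply: eqZp1_padd; zp.
apply: (eqZp_mulIl p_prime bu).
have -> : (b + 1 - p%:R) * binq (b + 1) p = (b + 1) * binq b p.
  rewrite /binq -/(ffq _ _) -/(ffq _ _) !mulrA [_ * ffq (b + 1) _]mulrC -ffqSr.
  by rewrite ffqSl addrK.
apply: eqZpM => //; last exact/IH/ltnW.
apply: eqZp_sym.
have -> : b + 1 - p%:R = p%:R * (-1) + (b + 1) by ring.
by apply: eqZp1_padd; rewrite /b; zp.
Qed.

Lemma fermat_quot2E : 2 ^+ p.-1 = 1 + p%:R * fermat_quot2 p :> rat.
Proof. by rewrite /fermat_quot2; field. Qed.

Lemma fermat_quot2_Zp : fermat_quot2 p \in Zp_loc p.
Proof.
have cop : coprime 2 p by rewrite coprime_sym prime_coprime // gtnNdvd.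
have := Euler_exp_totient cop; rewrite totient_prime // => /eqP.
rewrite eqn_mod_dvd ?expn_gt0 // => /dvdnP[k kE].
rewrite /fermat_quot2 -natrX -(@natrB _ _ 1) ?expn_gt0 // kE natrM mulfK //.
by zp.
Qed.

(** Here C(2p, p) is congruent to 2 by [binq_p_mod], and 4^p = (2 (1 + p q))^2 to 4. *)
Lemma cbin_p_mod : eqZp p 1 (cbin p) (1 / 2).
Proof.
have qZ := fermat_quot2_Zp.
have u2 := punit2.
have pw : 2 ^+ p = 2 * (1 + p%:R * fermat_quot2 p) :> rat.
  by rewrite -fermat_quot2E -exprS prednK // prime_gt0.
rewrite /cbin (natrM _ 2 2) exprMn pw.
apply: (eqZp_mulIl p_prime u2).
have wu : punit p (1 + p%:R * fermat_quot2 p).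
  apply: (@punit_eqZp _ p_prime _ 1); last exact: punit1.
  by rewrite addrC; apply: eqZp1_padd; zp.
have w0 := punit_neq0 wu.
apply: (eqZp_mulIl p_prime (punitM p_prime u2 (punitM p_prime wu wu))).
move: (fermat_quot2 p) qZ wu w0 => q' qZ wu w0.
have -> : 2 * ((1 + p%:R * q') * (1 + p%:R * q')) *
    (2 * ('C(p.*2, p)%:R /
      (2 * (1 + p%:R * q') * (2 * (1 + p%:R * q'))))) = 'C(p.*2, p)%:R.
  by field.
have -> : 2 * ((1 + p%:R * q') * (1 + p%:R * q')) * (2 * (1 / 2)) =
    2 * ((1 + p%:R * q') * (1 + p%:R * q')) by field.
apply: (@eqZp_trans _ p_prime _ 2).
  rewrite -binq_nat -muln2 natrM -[_ * _]addr0.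
  by apply: (@binq_p_mod _ 0); [zp | exact: prime_gt0].
rewrite -[X in eqZp _ _ X _]mulr1; apply: eqZp_sym.
have wm : eqZp p 1 (1 + p%:R * q') 1.
  by rewrite addrC; apply: eqZp1_padd; zp.
apply: eqZpMl; rewrite ?Zp_natr //.
by rewrite -[X in eqZp _ _ _ X]mulr1; apply: eqZpM.
Qed.

(** Since -1 - a = p (- x - 1) + (p - 1 - r), the two binomials at k = p are congruent to x and - x
    - 1. *)
Lemma summand_p_mod (x : rat) (r : nat) : x \in Zp_loc p -> (r < p)%N ->
  eqZp p 1 (summand (p%:R * x + r%:R) p) (- (x * (x + 1) / 2)).
Proof.
move=> xZ rp; set a := p%:R * x + r%:R.
rewrite summand_cbin.
have -> : - (x * (x + 1) / 2) = x * (- x - 1) * (1 / 2) by field.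
apply: eqZpM => //; last exact: cbin_p_mod.
apply: eqZpM => //; first exact: binq_p_mod.
have -> : -1 - a = p%:R * (- x - 1) + (p.-1 - r)%N%:R.
  rewrite natrB; last by nat_lia.
  by rewrite /a p_pred; ring.
by apply: binq_p_mod; [zp | nat_lia].
Qed.

Lemma binq_Zp (a : rat) (k : nat) : a \in Zp_loc p -> (k < p)%N ->
  binq a k \in Zp_loc p.
Proof.
by move=> aZ kp; rewrite /binq -/(ffq _ _) ZpM ?ffq_Zp // punitV_Zp // punit_fact.
Qed.

Lemma summand_Zp (a : rat) (k : nat) : a \in Zp_loc p -> (k < p)%N ->
  summand a k \in Zp_loc p.
Proof.
move=> aZ kp.
rewrite summand_cbin.
by apply: ZpM => //; [apply: ZpM => //; apply: binq_Zp => //; zp | exact: cbin_Zp].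
Qed.

Lemma Ssum_Zp (a : rat) : a \in Zp_loc p -> Ssum p a \in Zp_loc p.
Proof.
move=> aZ; rewrite /Ssum big_mkord; apply: Zp_sum => // i _.
exact: summand_Zp.
Qed.

(** * The recurrence from a to a + 2 modulo p^3 *)

Lemma Ssum_p_step2 (a : rat) :
  (a + 2) ^+ 2 * Ssum p (a + 2) - (a + 1) ^+ 2 * Ssum p a =
  p%:R ^+ 2 * ((4 * a + 6) * binq (a + p%:R) p * (ffq a (p - 2) / p.-1`!%:R) * cbin p).
Proof.
have := Ssum_step2 p.-1 a; rewrite prednK ?prime_gt0 // => ->.
(* Cutting the run of 2p - 2 factors after the first p exposes [p!]. This gives one factor p; the
   other is [n.+1] = p. *)
rewrite sign_pred (_ : (p.-1 + p.-1)%N = (p + (p - 2))%N); last by nat_lia.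
rewrite ffq_add addrK.
have -> : ffq (a + p%:R) p = p`!%:R * binq (a + p%:R) p.
  by rewrite /binq -/(ffq _ _) mulrC divfK ?fact_neq0.
by rewrite pfact; field; rewrite fact_neq0.
Qed.

(** The third factor p comes from [ffq b (p - 2)]: it lacks only b + 1 - p and b + 2 - p of the p
    factors of p! C(b, p), and these two are units because r + 2 < p. *)
Lemma Ssum_step2_mod (x : rat) (r : nat) (b := p%:R * x + r%:R) :
  x \in Zp_loc p -> (r.+2 < p)%N ->
  eqZp p 3 ((b + 2) ^+ 2 * Ssum p (b + 2)) ((b + 1) ^+ 2 * Ssum p b).
Proof.
move=> xZ rp.
have bZ : b \in Zp_loc p by rewrite /b; zp.
have e1 : eqZp p 1 (binq (b + p%:R) p) (x + 1).
  have -> : b + p%:R = p%:R * (x + 1) + r%:R by rewrite /b; ring.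
  by apply: binq_p_mod; [zp | nat_lia].
have e2 : eqZp p 1 (binq b p) x by apply: binq_p_mod => //; nat_lia.
have u j : (0 < r + j < p)%N -> punit p (b + j%:R - p%:R).
  move=> hj; apply: (@punit_eqZp _ p_prime _ (r + j)%:R); last exact: punit_small.
  have -> : b + j%:R - p%:R = p%:R * (x - 1) + (r + j)%:R by rewrite /b natrD; ring.
  by apply: eqZp1_padd; zp.
have u1 : punit p (b + 1 - p%:R) by apply: (u 1%N); nat_lia.
have u2 : punit p (b + 2 - p%:R) by apply: (u 2%N); nat_lia.
have F : ffq b (p - 2) / p.-1`!%:R =
   p%:R * (binq b p / ((b + 1 - p%:R) * (b + 2 - p%:R))).
  have E : ffq b p = ffq b (p - 2) * (b + 2 - p%:R) * (b + 1 - p%:R).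
    have {1}-> : p = (p - 2).+2 by nat_lia.
    by rewrite !ffqSr -natr1 natrB; [ring|nat_lia].
  rewrite /binq -/(ffq _ _) E pfact; field.
  by rewrite p0 fact_neq0 (punit_neq0 u1) (punit_neq0 u2).
apply: (eqZp_padd p_prime (z := (4 * b + 6) * binq (b + p%:R) p *
   (binq b p / ((b + 1 - p%:R) * (b + 2 - p%:R))) * cbin p)).
- by have := Ssum_Zp bZ => ?; zp.
- have ? := eqZp_l e1; have ? := eqZp_l e2; have ? := cbin_Zp p.
  by zp; apply: punitV_Zp; apply: punitM.
by rewrite -[LHS](subrK ((b + 1) ^+ 2 * Ssum p b)) Ssum_p_step2 F; ring.
Qed.

(** * The sum at p x as a quadratic polynomial in x modulo p^3 *)

Lemma ffq_mid_mod (x : rat) (m : nat) : x \in Zp_loc p ->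
  eqZp p 2 (ffq (p%:R * x - 1) m * ffq (-1 - p%:R * x) m) (m`!%:R ^+ 2).
Proof.
move=> xZ; rewrite /ffq -big_split fact_sqr_prod; apply: eqZp_prod => //= i _.
by apply: (eqZp_padd p_prime (z := - x ^+ 2)); [zp | zp | ring].
Qed.

(** In the term k = m + 1 the outer factors are p x and -(m + 1 + p x); the inner ones pair up as (i
    + 1)^2 - (p x)^2, constant modulo p^2. The factor p x lifts this to p^3, so the term is
    congruent to - c p x (m + 1 + p x) with [c] independent of x. *)
Lemma Ssum_pmul_quad_aux (m : nat) : (m < p)%N ->
  exists A B, [/\ A \in Zp_loc p, B \in Zp_loc p & forall x, x \in Zp_loc p ->
    eqZp p 3 (Ssum m.+1 (p%:R * x)) (1 + p%:R * A * x + p%:R ^+ 2 * B * x ^+ 2)].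
Proof.
elim: m => [|m IH] mp.
  exists 0, 0; split; [exact: (Zp_natr p_prime 0)|exact: (Zp_natr p_prime 0)|].
  move=> x xZ; rewrite Ssum1 !(mulr0, mul0r, addr0).
  by apply: eqZp_refl => //; zp.
have [A [B [AZ BZ AB]]] := IH (ltnW mp).
pose c := m`!%:R ^+ 2 * cbin m.+1 / m.+1`!%:R ^+ 2.
have cZ : c \in Zp_loc p.
  have ? := cbin_Zp m.+1.
  rewrite /c; zp; apply: punitV_Zp; apply: punitX => //.
  exact: punit_fact.
exists (A - m.+1%:R * c), (B - c); split; [by zp | by zp |].
move=> x xZ; rewrite SsumS.
have -> : 1 + p%:R * (A - m.+1%:R * c) * x + p%:R ^+ 2 * (B - c) * x ^+ 2 =
  (1 + p%:R * A * x + p%:R ^+ 2 * B * x ^+ 2) +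
  p%:R ^+ 1 * (m`!%:R ^+ 2 *
     (x * (- (m.+1%:R + p%:R * x)) * (cbin m.+1 / m.+1`!%:R ^+ 2))).
  by rewrite /c; ring.
apply: eqZpD => //; first exact: AB.
have -> : summand (p%:R * x) m.+1 = p%:R ^+ 1 *
  ((ffq (p%:R * x - 1) m * ffq (-1 - p%:R * x) m) *
  (x * (- (m.+1%:R + p%:R * x)) * (cbin m.+1 / m.+1`!%:R ^+ 2))).
  rewrite /summand /binq -!/(ffq _ _) ffqSl ffqSr /cbin -natr1; field.
  by rewrite fact_neq0 expf_neq0.
apply: (@eqZp_pmul _ p_prime 1 2); apply: eqZpMr => //; last exact: ffq_mid_mod.
have ? := cbin_Zp m.+1.
zp; apply: punitV_Zp; apply: punitX => //.
exact: punit_fact.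
Qed.

Lemma Ssum_pmul_quad :
  exists A B, [/\ A \in Zp_loc p, B \in Zp_loc p & forall x, x \in Zp_loc p ->
    eqZp p 3 (Ssum p (p%:R * x)) (1 + p%:R * A * x + p%:R ^+ 2 * B * x ^+ 2)].
Proof.
have := @Ssum_pmul_quad_aux p.-1; rewrite prednK ?prime_gt0 //; apply.
by have := prime_gt0 p_prime; nat_lia.
Qed.

(** * Wolstenholme's congruence and the value at p *)

Lemma prod_one_add (n : nat) (f : nat -> rat) :
  (forall i, (i < n)%N -> f i \in Zp_loc p) ->
  eqZp p 3 (\prod_(i < n) (1 + p%:R ^+ 2 * f i)) (1 + p%:R ^+ 2 * \sum_(i < n) f i).
Proof.
elim: n => [|n IH] fZ.
  by rewrite !big_ord0 mulr0 addr0; apply: eqZp_refl => //; zp.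
rewrite !big_ord_recr /=.
have fn : f n \in Zp_loc p by apply: fZ.
have SZ : \sum_(i < n) f i \in Zp_loc p.
  by apply: Zp_sum => // i _; apply: fZ; apply: leqW.
have IHn : eqZp p 3 (\prod_(i < n) (1 + p%:R ^+ 2 * f i))
    (1 + p%:R ^+ 2 * \sum_(i < n) f i).
  by apply: IH => i hi; apply: fZ; apply: leqW.
move: SZ IHn; set S := \sum_(i < n) f i => SZ IHn.
apply: (@eqZp_trans _ p_prime _ ((1 + p%:R ^+ 2 * S) * (1 + p%:R ^+ 2 * f n))).
  by apply: eqZpMr => //; zp.
apply: (eqZp_padd p_prime (z := p%:R * S * f n)); [by zp|by zp|ring].
Qed.

Let inv2 (i : nat) : rat := (i.+1%:R ^+ 2)^-1.

Let inv2_Zp (i : nat) : (i.+1 < p)%N -> inv2 i \in Zp_loc p.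
Proof.
by move=> ip; apply: punitV_Zp; apply: punitX => //; apply: punit_small.
Qed.

Let inv2_opp (i j : nat) : (i.+1 + j.+1 = p)%N -> eqZp p 1 (inv2 i) (inv2 j).
Proof.
move=> ij; apply: eqZpV => //.
- by apply: punitX => //; apply: punit_small => //; nat_lia.
- by apply: punitX => //; apply: punit_small => //; nat_lia.
have -> : i.+1%:R = p%:R - j.+1%:R :> rat by rewrite -ij natrD addrK.
apply: (eqZp_padd p_prime (z := p%:R - 2 * j.+1%:R)); [by zp | by zp | ring].
Qed.

(* With [A] the first and [T] the second sum, splitting [T] into halves gives
   [T = 2 A], splitting it by parity gives [T = A / 2]; hence [3 A / 2 = 0]. *)
Lemma sum_inv2_mod : (3 < p)%N ->
  eqZp p 1 (\sum_(i < h) inv2 i) 0 /\ eqZp p 1 (\sum_(i < p.-1) inv2 i) 0.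
Proof.
move=> p3; set A := \sum_(i < h) _; set T := \sum_(i < p.-1) _.
have AZ : A \in Zp_loc p.
  by apply: Zp_sum => // i _; apply: inv2_Zp; case: i => i /=; nat_lia.
have TA : eqZp p 1 T (A + A).
  rewrite /T p1E -addnn big_split_ord /=; apply: eqZpD => //; first exact: eqZp_refl.
  rewrite (reindex_inj rev_ord_inj) /=; apply: eqZp_sum => // i _.
  by apply: inv2_opp; case: i => i /=; nat_lia.
have TA4 : eqZp p 1 T (A * (1 / 2)).
  rewrite /T p1E (big_ord_double _ _ inv2) big_split /=.
  have -> : A * (1 / 2) = A * (1 / 4) + A * (1 / 4) by field.
  have E : A * (1 / 4) = \sum_(i < h) inv2 (i.*2.+1).
    rewrite /A mulr_suml; apply: eq_bigr => i _; rewrite /inv2.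
    rewrite -[in RHS]doubleS -muln2 natrM.
    have : i.+1%:R != 0 :> rat by rewrite pnatr_eq0.
    by move: (i.+1%:R) => z z0; field.
  have EZ : A * (1 / 4) \in Zp_loc p.
    by rewrite E; apply: Zp_sum => // i _; apply: inv2_Zp; case: i => i /=; nat_lia.
  apply: eqZpD => //; last by rewrite -E; apply: eqZp_refl.
  (* [inv2 i] belongs to the integer i + 1; the map j -> p - j sends the odd integers below p to the
     even ones, in reverse order. *)
  rewrite E [X in eqZp _ _ _ X](reindex_inj rev_ord_inj) /=.
  by apply: eqZp_sum => // i _; apply: inv2_opp; case: i => i /=; nat_lia.
have A0 : eqZp p 1 A 0.
  have u3 : punit p (3 / 2).
    apply: punitM => //; first by apply: (punit_small p_prime (k := 3)).
    by apply: punitV; apply: punit2.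
  apply: (eqZp_mulIl p_prime u3); rewrite mulr0.
  have -> : 3 / 2 * A = A + A - A * (1 / 2) by field.
  rewrite -(subrr T); apply: eqZpD => //; first exact: eqZp_sym.
  by apply: eqZpN; apply: eqZp_sym.
split=> //; apply: (eqZp_trans p_prime TA); rewrite -(addr0 0).
exact: eqZpD.
Qed.

(* Wolstenholme's congruence: multiply [prod (1 + p / j)] by
   [prod (1 - p / j) = 1]. *)
Lemma ffq_2p_mod : (3 < p)%N ->
  eqZp p 3 (ffq (p%:R + p.-1%:R) p.-1) p.-1`!%:R.
Proof.
move=> p3; have F0 : p.-1`!%:R != 0 :> rat := fact_neq0 _.
have -> : ffq (p%:R + p.-1%:R) p.-1 =
    p.-1`!%:R * \prod_(i < p.-1) (1 + p%:R ^+ 2 * - inv2 i).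
  apply: (mulfI F0); rewrite mulrA -expr2 fact_sqr_prod -[in RHS]big_split /=.
  (* After reflection the factors pair up as (p - 1 - i) (-1 - p - i) = (i + 1)^2 - p^2. *)
  rewrite -[LHS]mul1r -{1}(sign_pred) mulrCA -ffq_reflect -ffq_fact.
  rewrite /ffq -big_split /=; apply: eq_bigr => i _.
  have -> : p.-1%:R = p%:R - 1 :> rat by rewrite pE p1E -muln2 natrM; ring.
  rewrite /inv2 -natr1; have : i%:R + 1 != 0 :> rat by rewrite natr1 pnatr_eq0.
  by move=> ?; field.
rewrite -[X in eqZp _ _ _ X]mulr1; apply: eqZpMl => //; first by zp.
have fZ i : (i < p.-1)%N -> - inv2 i \in Zp_loc p.
  by move=> ip; apply: ZpN => //; apply: inv2_Zp; nat_lia.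
apply: (eqZp_trans p_prime (prod_one_add fZ)).
rewrite -[X in eqZp _ _ _ X]addr0; apply: eqZpD => //; first by apply: eqZp_refl; zp.
rewrite -[X in eqZp _ _ _ X](mulr0 (p%:R ^+ 2)); apply: (@eqZp_pmul _ p_prime 2 1).
rewrite sumrN -oppr0; apply: eqZpN => //.
by have [] := sum_inv2_mod p3.
Qed.

(** C(2p, p) = 2 (2p - 1) ... (p + 1) / (p - 1)!, to which [ffq_2p_mod] applies. *)
Lemma bin_2p_mod : (3 < p)%N -> eqZp p 3 ('C(p.*2, p))%:R 2.
Proof.
move=> p3; rewrite -binq_nat /binq -/(ffq _ _).
have -> : ffq p.*2%:R p = 2 * p%:R * ffq (p%:R + p.-1%:R) p.-1.
  rewrite -{2}(prednK (prime_gt0 p_prime)) ffqSl.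
  have -> : p.*2%:R = 2 * p%:R :> rat by rewrite -muln2 natrM mulrC.
  by congr (_ * ffq _ _); rewrite pE p1E -muln2 natrM; ring.
have F0 : p.-1`!%:R != 0 :> rat := fact_neq0 _.
rewrite pfact.
have -> : 2 * p%:R * ffq (p%:R + p.-1%:R) p.-1 / (p%:R * p.-1`!%:R) =
  2 * (ffq (p%:R + p.-1%:R) p.-1 / p.-1`!%:R) by field; rewrite F0 p0.
rewrite -[X in eqZp _ _ _ X]mulr1; apply: eqZpMl => //; first by zp.
rewrite -[X in eqZp _ _ _ X](mulfV F0); apply: eqZpMr => //; last exact: ffq_2p_mod.
by apply: punitV_Zp; apply: punit_fact_pred.
Qed.

Let wu : punit p w.
Proof. by apply: punitX => //; apply: punit2. Qed.

(** As p is odd, the sum up to k = p vanishes, so S(p) is minus its last term, C(2p, p)^2 / 4^p,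
    with 4^p = (2 w)^2. *)
Lemma Ssum_at_p : (3 < p)%N -> eqZp p 3 (w ^+ 2 * Ssum p p%:R) 1.
Proof.
move=> p3.
have E : Ssum p p%:R = - summand p%:R p.
  have hp : (h.*2 < p)%N by nat_lia.
  have := Ssum_odd_nat hp; rewrite -p1E prednK ?prime_gt0 // SsumS.
  by move/eqP; rewrite addr_eq0 => /eqP.
have w0 := punit_neq0 wu.
have -> : w ^+ 2 * Ssum p p%:R = (('C(p.*2, p))%:R / 2) ^+ 2.
  rewrite E /summand binq_nat binn.
  have -> : binq (-1 - p%:R) p = - ('C(p.*2, p))%:R.
    rewrite -binq_nat /binq -!/(ffq _ _) ffq_reflect -natrD addnn.
    by rewrite -signr_odd p_odd expr1 mulN1r mulNr.
  have -> : 4 ^+ p = (2 * w) ^+ 2 :> rat.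
    by rewrite /w -exprS prednK ?prime_gt0 // (natrM _ 2 2) exprMn expr2.
  by field.
have -> : 1 = (2 * 2^-1) ^+ 2 :> rat by [].
apply: eqZpX => //; apply: eqZpMr => //; last exact: bin_2p_mod.
by apply: punitV_Zp; apply: punit2.
Qed.

(** * Morley's congruence and the value at -p *)

Let X : rat := \prod_(j < h) (1 - p%:R / (2 * j.+1%:R)).
Let Y : rat := \prod_(j < h) (1 - p%:R / j.+1%:R).

Let prod_odd_fact : (h.*2)`!%:R = \prod_(j < h) (j.*2.+1)%:R * (2 ^+ h * h`!%:R) :> rat.
Proof.
elim: h => [|n IH]; first by rewrite big_ord0 !mul1r.
rewrite doubleS !factS !natrM IH big_ord_recr /= exprS.
by rewrite -[n.*2.+2]doubleS -!muln2 natrM; ring.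
Qed.

(** The numerators 2j - p of [X] are the negatives of the odd numbers below p, and those of [Y],
    namely j - p, the negatives of p - 1, ..., p - h, so that Y h!^2 = (-1)^h (2h)!. Splitting (2h)!
    into odd and even factors leaves 2^(2h) = w. *)
Let YE : Y = X * w.
Proof.
have hf : h`!%:R != 0 :> rat := fact_neq0 _.
have h2 : (2 ^+ h : rat) != 0 by rewrite expf_neq0.
have XE : X * (2 ^+ h * h`!%:R) = (-1) ^+ h * \prod_(j < h) (j.*2.+1)%:R.
  have -> : 2 ^+ h * h`!%:R = \prod_(j < h) (2 * j.+1%:R) :> rat.
    by rewrite big_split /= prodr_const card_ord; congr (_ * _); rewrite fact_prod_ord.
  have -> : (-1) ^+ h = \prod_(j < h) (-1) :> rat by rewrite prodr_const card_ord.
  rewrite /X -!big_split /= [RHS](reindex_inj rev_ord_inj) /=; apply: eq_bigr => j _.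
  have jh := ltn_ord j.
  have -> : (h - j.+1).*2.+1%:R = p%:R - 2 * j.+1%:R :> rat.
    rewrite pE -muln2 -natr1 natrM natrB //; ring.
  have : j.+1%:R != 0 :> rat by rewrite pnatr_eq0.
  by move: (j.+1%:R) => z z0; field.
have YF : Y * h`!%:R ^+ 2 = (-1) ^+ h * (h.*2)`!%:R.
  have -> : (h.*2)`!%:R = ffq p.-1%:R h * h`!%:R :> rat.
    have hh : (h <= h.*2)%N by rewrite -addnn leq_addr.
    have := ffact_fact hh; rewrite -{2}addnn addnK => <-.
    by rewrite ffq_nat p1E natrM.
  rewrite expr2 !mulrA; congr (_ * _).
  rewrite fact_prod_ord.
  have -> : (-1) ^+ h = \prod_(j < h) (-1) :> rat by rewrite prodr_const card_ord.
  rewrite /Y /ffq -!big_split /=; apply: eq_bigr => j _.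
  have -> : p.-1%:R = p%:R - 1 :> rat by rewrite pE p1E -muln2 natrM; ring.
  have -> : p%:R - 1 - j%:R = p%:R - j.+1%:R :> rat by rewrite -natr1; ring.
  have : j.+1%:R != 0 :> rat by rewrite pnatr_eq0.
  by move: (j.+1%:R) => z z0; field.
apply: (mulIf (expf_neq0 2 hf)); rewrite YF prod_odd_fact.
have -> : X * w * h`!%:R ^+ 2 = X * (2 ^+ h * h`!%:R) * (2 ^+ h * h`!%:R).
  by rewrite /w p1E -muln2 exprM expr2; ring.
by rewrite XE; ring.
Qed.

(* Morley's congruence in disguise: [Y = X w] exactly, while [Y] is congruent to
   [X ^ 2] because the sum of the inverse squares up to [h] vanishes mod [p]. *)
Lemma prod_half_mod : (3 < p)%N -> eqZp p 3 X w.
Proof.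
move=> p3.
have Xu : punit p X.
  have E1 : eqZp p 1 X 1.
    have -> : 1 = \prod_(j < h) (1 : rat) by rewrite big1.
    apply: eqZp_prod => // j _.
    apply: (eqZp_padd p_prime (z := - (2 * j.+1%:R)^-1)).
    - by zp.
    - apply: ZpN; apply: punitV_Zp; apply: punitM => //; first exact: punit2.
      by apply: punit_small => //; case: j => j /=; nat_lia.
    - by rewrite expr1; ring.
  by apply: (punit_eqZp p_prime E1); apply: punit1.
apply: (eqZp_mulIl p_prime Xu); rewrite -YE -expr2 /X /Y -prodrXl.
have jZ (j : 'I_h) : (j.+1%:R)^-1 \in Zp_loc p.
  apply: punitV_Zp; apply: punit_small => //; case: j => j /=; nat_lia.
have hZ : 2^-1 \in Zp_loc p by apply: punitV_Zp; apply: punit2.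
(* Factor by factor, (1 - p/(2j))^2 and (1 - p/j) (1 + p^2/(4 j^2)) differ by p^3/(4 j^3). *)
apply: (@eqZp_trans _ p_prime _
  (Y * \prod_(j < h) (1 + p%:R ^+ 2 * (inv2 j * (2^-1) ^+ 2)))).
  rewrite /Y -big_split /=; apply: eqZp_prod => // j _.
  have j0 : j.+1%:R != 0 :> rat by rewrite pnatr_eq0.
  apply: (eqZp_padd p_prime (z := (j.+1%:R)^-1 ^+ 3 * (2^-1) ^+ 2)).
  - by have ? := jZ j; rewrite /inv2 -exprVn; zp.
  - by have ? := jZ j; zp.
  by rewrite /inv2; move: (j.+1%:R) j0 => z z0; field.
have YZ : Y \in Zp_loc p by apply: Zp_prod => // j _; have ? := jZ j; zp.
rewrite -[X in eqZp _ _ _ X]mulr1; apply: eqZpMl => //.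
have fZ i : (i < h)%N -> inv2 i * (2^-1) ^+ 2 \in Zp_loc p.
  by move=> ip; have ? : inv2 i \in Zp_loc p by [apply: inv2_Zp; nat_lia]; zp.
apply: (eqZp_trans p_prime (prod_one_add fZ)).
rewrite -[X in eqZp _ _ _ X]addr0; apply: eqZpD => //; first by apply: eqZp_refl; zp.
rewrite -[X in eqZp _ _ _ X](mulr0 (p%:R ^+ 2)); apply: (@eqZp_pmul _ p_prime 2 1).
rewrite -mulr_suml -(mul0r ((2^-1) ^+ 2)); apply: eqZpMr => //; first by zp.
by have [] := sum_inv2_mod p3.
Qed.

Let Zhalf : 2^-1 \in Zp_loc p.
Proof. by apply: punitV_Zp; apply: punit2. Qed.

Let qZ : q \in Zp_loc p.
Proof. exact: fermat_quot2_Zp. Qed.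

(** Iterates the recurrence from -p; the points -p + 2j with j < h have residue 2j with 2j + 2 < p,
    as [Ssum_step2_mod] demands. *)
Lemma Ssum_neg_p_chain (n : nat) : (n <= h)%N ->
  eqZp p 3 (\prod_(j < n) (j.*2.+2%:R - p%:R) ^+ 2 * Ssum p (- p%:R + n.*2%:R))
    (\prod_(j < n) (j.*2.+1%:R - p%:R) ^+ 2 * Ssum p (- p%:R)).
Proof.
elim: n => [|n IH] nh.
  rewrite !big_ord0 addr0; apply: eqZp_refl => //; apply: ZpM; [by []| by zp|].
  by apply: Ssum_Zp => //; zp.
pose b : rat := p%:R * (-1) + n.*2%:R.
have bE : b = - p%:R + n.*2%:R by rewrite /b mulrN1.
have b2 : - p%:R + (n.+1).*2%:R = b + 2 by rewrite bE doubleS -!natr1; ring.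
have f2 : n.*2.+2%:R - p%:R = b + 2 by rewrite -b2 doubleS addrC.
have f1 : n.*2.+1%:R - p%:R = b + 1 by rewrite bE -natr1; ring.
rewrite !big_ord_recr /= f1 f2 b2.
have Zprod (F : nat -> nat) m :
    \prod_(j < m) ((F j)%:R - p%:R) ^+ 2 \in Zp_loc p by zp.
apply: (@eqZp_trans _ p_prime _ (\prod_(j < n) (j.*2.+2%:R - p%:R) ^+ 2 *
  ((b + 1) ^+ 2 * Ssum p b))).
  rewrite -mulrA; apply: eqZpMl => //; first exact: (Zprod (fun j => j.*2.+2)).
  by apply: Ssum_step2_mod => //; [zp | nat_lia].
rewrite mulrCA [X in eqZp _ _ _ X]mulrAC [X in eqZp _ _ _ X]mulrC.
apply: eqZpMl => //; first by rewrite /b; zp.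
by rewrite bE; apply: IH; apply: ltnW.
Qed.

(** At n = h the chain reaches -1, where the sum is 1 by symmetry. The ratio of the two products is
    [X ^ 2], hence w^2. *)
Lemma Ssum_at_neg_p : (3 < p)%N -> eqZp p 3 (Ssum p (- p%:R)) (w ^+ 2).
Proof.
move=> p3.
have := Ssum_neg_p_chain (leqnn h).
have -> : - p%:R + h.*2%:R = -1 - 0 :> rat by rewrite pE -muln2 natrM; ring.
rewrite Ssum_sym -[p in Ssum p 0](prednK (prime_gt0 p_prime)) Ssum_zero mulr1.
set D := \prod_(j < h) (2 * j.+1%:R) : rat.
have Du : punit p D.
  rewrite /D; elim/big_ind: _ => [||j _]; first exact: punit1.
    by move=> *; apply: punitM.
  apply: punitM => //; first exact: punit2.
  by apply: punit_small => //; case: j => j /=; nat_lia.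
have -> : \prod_(j < h) (j.*2.+2%:R - p%:R) ^+ 2 = D ^+ 2 * X ^+ 2.
  rewrite -exprMn /D /X -big_split -prodrXl; apply: eq_bigr => j _ /=.
  have -> : j.*2.+2%:R = 2 * j.+1%:R :> rat by rewrite -doubleS -muln2 natrM mulrC.
  have : j.+1%:R != 0 :> rat by rewrite pnatr_eq0.
  by move: (j.+1%:R) => z z0; field.
(* Up to sign, the 2j + 1 - p are the even numbers below p in reverse order. *)
have -> : \prod_(j < h) (j.*2.+1%:R - p%:R) ^+ 2 = D ^+ 2.
  rewrite /D -prodrXl [RHS](reindex_inj rev_ord_inj) /=; apply: eq_bigr => j _.
  have jh := ltn_ord j.
  have -> : 2 * (h - j.+1).+1%:R = p%:R - j.*2.+1%:R :> rat.
    rewrite pE -[(h - j.+1).+1%:R]natr1 natrB // -[j.*2.+1%:R]natr1.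
    by rewrite -[j.+1%:R]natr1 -muln2 natrM; ring.
  by ring.
move/(eqZp_mulIl p_prime (punitX p_prime 2 Du)) => E.
apply: eqZp_trans (eqZpX p_prime 2 (prod_half_mod p3)) => //.
exact: eqZp_sym.
Qed.

(** * Truncated exponentials and the value at p x *)

Lemma texp_Zp (u v : rat) : u \in Zp_loc p -> v \in Zp_loc p ->
  texp p u v \in Zp_loc p.
Proof. by move=> uZ vZ; rewrite /texp; zp. Qed.

(** The product p^2 u u' supplies the cross term of (u + u')^2; the witness collects the terms of
    order 3 and 4. *)
Lemma texpM (u v u' v' : rat) :
  u \in Zp_loc p -> v \in Zp_loc p -> u' \in Zp_loc p -> v' \in Zp_loc p ->
  eqZp p 3 (texp p u v * texp p u' v') (texp p (u + u') (v + v')).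
Proof.
move=> uZ vZ uZ' vZ'; apply: (eqZp_padd p_prime
  (z := 2^-1 * (u * (u' ^+ 2 + v') + u' * (u ^+ 2 + v))
        + p%:R * (2^-1) ^+ 2 * (u ^+ 2 + v) * (u' ^+ 2 + v'))).
- by apply: texp_Zp; zp.
- by zp.
by rewrite /texp; field.
Qed.

(** From log(1 + p c) = p c - p^2 c^2 / 2 + ..., the number 1 + p c is exactly
    [texp p c (- c ^ 2)]. *)
Lemma sqr_texp (c : rat) : c \in Zp_loc p ->
  eqZp p 3 ((1 + p%:R * c) ^+ 2) (texp p (2 * c) (- (2 * c ^+ 2))).
Proof.
move=> cZ; have -> : 2 * c = c + c by ring.
have -> : - (2 * c ^+ 2) = - c ^+ 2 + - c ^+ 2 by ring.
rewrite expr2 (_ : 1 + p%:R * c = texp p c (- c ^+ 2)).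
  by apply: texpM; zp.
by rewrite /texp; field.
Qed.

(** The values at x = 1 and x = -1 are (1 + p q)^-2 and (1 + p q)^2; half their difference and half
    their sum determine p A and p^2 B modulo p^3. *)
Lemma Ssum_pmul (x : rat) : (3 < p)%N -> x \in Zp_loc p ->
  eqZp p 3 (Ssum p (p%:R * x)) (texp p (- (2 * x * q)) (2 * x * q ^+ 2)).
Proof.
move=> p3 xZ.
have [A [B [AZ BZ AB]]] := Ssum_pmul_quad.
apply: (eqZp_trans p_prime (AB x xZ)).
have wE : w = 1 + p%:R * q by apply: fermat_quot2E.
have e1 : eqZp p 3 (1 + p%:R * A + p%:R ^+ 2 * B)
    (1 - 2 * p%:R * q + 3 * p%:R ^+ 2 * q ^+ 2).
  have := AB 1 (Zp_natr p_prime 1); rewrite expr1n !mulr1 => S1.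
  have w2u : punit p (w ^+ 2).
    by apply: punitX => //; apply: punitX => //; apply: punit2.
  apply: (eqZp_mulIl p_prime w2u).
  apply: (@eqZp_trans _ p_prime _ (w ^+ 2 * Ssum p p%:R)).
    by apply: eqZpMl; rewrite ?punit_Zp //; apply: eqZp_sym.
  apply: (eqZp_trans p_prime (Ssum_at_p p3)).
  apply: eqZp_sym; rewrite wE.
  apply: (eqZp_padd p_prime (z := 4 * q ^+ 3 + 3 * p%:R * q ^+ 4)); [by zp|by zp|ring].
have e2 : eqZp p 3 (1 - p%:R * A + p%:R ^+ 2 * B) ((1 + p%:R * q) ^+ 2).
  have := AB (-1) (ZpN (Zp_natr p_prime 1)).
  rewrite !mulrN1 sqrrN expr1n mulr1 => /(eqZp_sym) S1.
  apply: (eqZp_trans p_prime S1); rewrite -wE.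
  exact: Ssum_at_neg_p.
have /eqZpP[//|_ [z1 z1Z E1]] := e1.
have /eqZpP[//|_ [z2 z2Z E2]] := e2.
have EA : p%:R * A =
    2^-1 * ((1 + p%:R * A + p%:R ^+ 2 * B) - (1 - p%:R * A + p%:R ^+ 2 * B)) by field.
have EB : p%:R ^+ 2 * B =
    2^-1 * ((1 + p%:R * A + p%:R ^+ 2 * B) + (1 - p%:R * A + p%:R ^+ 2 * B)) - 1.
  by field.
rewrite E1 E2 in EA EB; rewrite EA EB.
apply: (eqZp_padd p_prime (z := 2^-1 * (z1 - z2) * x + 2^-1 * (z1 + z2) * x ^+ 2)).
- by apply: texp_Zp; zp.
- by zp.
by rewrite /texp; field.
Qed.

(** * Harmonic numbers and the values at even and odd residues *)

Lemma harmS (n : nat) : harm n.+1 = harm n + (n.+1%:R)^-1.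
Proof. by rewrite /harm big_nat_recr. Qed.

Lemma harm2S (n : nat) : harm2 n.+1 = harm2 n + (n.+1%:R)^-1 ^+ 2.
Proof. by rewrite /harm2 big_nat_recr //= exprVn. Qed.

Let invZ (n : nat) : (n.+1 < p)%N -> (n.+1%:R)^-1 \in Zp_loc p.
Proof. by move=> np; apply: punitV_Zp; apply: punit_small. Qed.

Lemma harm_Zp (n : nat) : (n < p)%N -> harm n \in Zp_loc p.
Proof.
elim: n => [|n IH] np; first by rewrite /harm big_geq //; zp.
by rewrite harmS; have ? := IH (ltnW np); have ? := invZ np; zp.
Qed.

Lemma harm2_Zp (n : nat) : (n < p)%N -> harm2 n \in Zp_loc p.
Proof.
elim: n => [|n IH] np; first by rewrite /harm2 big_geq //; zp.
by rewrite harm2S; have ? := IH (ltnW np); have ? := invZ np; zp.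
Qed.

Lemma punit_bin (N k : nat) : (k <= N)%N -> (N < p)%N -> punit p ('C(N, k))%:R.
Proof.
move=> kN Np; have [kp nkp] : (k < p)%N /\ (N - k < p)%N by nat_lia.
have u := punitM p_prime (punit_fact p_prime kp) (punit_fact p_prime nkp).
have -> : ('C(N, k))%:R = N`!%:R / (k`!%:R * (N - k)`!%:R) :> rat.
  by rewrite -(bin_fact kN) !natrM mulfK // (punit_neq0 u).
by apply: punitM; rewrite ?punitV // punit_fact.
Qed.

Let half_lt (n : nat) : (n < h)%N -> (n.*2.+2 < p)%N.
Proof. by move: p1E p2; clear; lia. Qed.

Let half_le (n : nat) : (n <= h)%N -> (n < p)%N /\ (n.*2 < p)%N.
Proof. by move: p1E p2; clear; lia. Qed.

(** As 2h = p - 1, the ratio (h - n) / (n + 1) equals (p - 1 - 2n) / (2n + 2), which resembles the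
    factor (b + 1) / (b + 2) of the recurrence. *)
Lemma binS_half (n : nat) : (n < h)%N ->
  ('C(h, n.+1))%:R =
  - (('C(h, n))%:R * (n.*2.+1%:R - p%:R) * (n.*2.+2%:R)^-1) :> rat.
Proof.
move=> nh; have n0 : n.+1%:R != 0 :> rat by rewrite pnatr_eq0.
apply: (mulfI n0); rewrite -natrM mul_bin_left natrM natrB ?(ltnW nh) //.
have -> : n.*2.+2%:R = 2 * n.+1%:R :> rat by rewrite -doubleS -muln2 natrM mulrC.
have -> : n.*2.+1%:R = 2 * n.+1%:R - 1 :> rat.
  by rewrite -[n.*2.+1%:R]natr1 -[n.+1%:R]natr1 -muln2 natrM; ring.
have -> : n%:R = n.+1%:R - 1 :> rat by rewrite -[n.+1%:R]natr1; ring.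
by move: (n.+1%:R) n0 => z z0; rewrite pE; field.
Qed.

Lemma punit_bin_half (n : nat) : (n <= h)%N -> punit p ('C(h, n))%:R.
Proof.
move=> nh; apply: (punit_bin) => //.
by have [] := half_le (leqnn h).
Qed.

(** [expU] and [expV] are the exponents of first and second order in the main factor of the theorem,
    with 2n as the even index. *)
Definition expU (x : rat) (n : nat) : rat :=
  (2 * x + 2) * harm n.*2 - (2 * x + 1) * harm n - 2 * x * q.

Definition expV (x : rat) (n : nat) : rat :=
  2 * x * q ^+ 2 + 1 / 2 * (2 * x ^+ 2 - 1) * harm2 n
    + 2 * (1 - x ^+ 2) * harm2 n.*2.

Let expU_Zp (x : rat) (n : nat) : x \in Zp_loc p -> (n <= h)%N ->
  expU x n \in Zp_loc p.
Proof.
move=> xZ /half_le[np np2].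
have ? := harm_Zp np; have ? := harm_Zp np2.
by rewrite /expU; zp.
Qed.

Let expV_Zp (x : rat) (n : nat) : x \in Zp_loc p -> (n <= h)%N ->
  expV x n \in Zp_loc p.
Proof.
move=> xZ /half_le[np np2].
have ? := harm2_Zp np; have ? := harm2_Zp np2.
by rewrite /expV; zp.
Qed.

(** Induction along the recurrence from S(p x). Each step changes S by ((b + 1) / (b + 2))^2 and the
    binomial by [binS_half]; the quotient of the two is a product of truncated exponentials whose
    exponents are the increments of [expU] and [expV]. *)
Lemma Ssum_even (x : rat) (n : nat) : (3 < p)%N -> x \in Zp_loc p ->
  (n <= h)%N ->
  eqZp p 3 (Ssum p (p%:R * x + n.*2%:R))
    (('C(h, n))%:R ^+ 2 * texp p (expU x n) (expV x n)).
Proof.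
move=> p3 xZ; elim: n => [|n IH] nh.
  rewrite addr0 bin0 expr1n mul1r /expU /expV /harm /harm2 !big_geq //.
  rewrite !mulr0 subrr sub0r !addr0.
  exact: Ssum_pmul.
have np := half_lt nh.
set b := p%:R * x + n.*2%:R.
have bZ : b \in Zp_loc p by rewrite /b; zp.
have -> : p%:R * x + (n.+1).*2%:R = b + 2 by rewrite /b doubleS -!natr1; ring.
have bu : punit p (b + 2).
  apply: (@punit_eqZp _ p_prime _ n.*2.+2%:R); last exact: punit_small.
  have -> : b + 2 = p%:R * x + n.*2.+2%:R by rewrite /b -!natr1; ring.
  by apply: eqZp1_padd => //; zp.
apply: (eqZp_mulIl p_prime (punitX p_prime 2 bu)).
have S2 : eqZp p 3 ((b + 2) ^+ 2 * Ssum p (b + 2)) ((b + 1) ^+ 2 * Ssum p b).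
  exact: Ssum_step2_mod.
apply: (eqZp_trans p_prime S2).
have b1Z : (b + 1) ^+ 2 \in Zp_loc p by zp.
apply: (eqZp_trans p_prime (eqZpMl p_prime b1Z (IH (ltnW nh)))).
(* Then b + 1 = (2n + 1) (1 + p x c), b + 2 = (2n + 2) (1 + p x d) and 2n + 1 - p = (2n + 1) (1 - p
   c). *)
set c : rat := (n.*2.+1%:R)^-1; set d : rat := (n.*2.+2%:R)^-1.
have cZ : c \in Zp_loc p by apply/invZ/ltnW.
have dZ : d \in Zp_loc p by apply: invZ.
have UZ := expU_Zp xZ (ltnW nh); have VZ := expV_Zp xZ (ltnW nh).
have UZ' := expU_Zp xZ nh; have VZ' := expV_Zp xZ nh.
have c0 : n.*2.+1%:R != 0 :> rat by rewrite pnatr_eq0.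
have d0 : n.*2.+2%:R != 0 :> rat by rewrite pnatr_eq0.
have -> : (b + 1) ^+ 2 * (('C(h, n))%:R ^+ 2 * texp p (expU x n) (expV x n)) =
  n.*2.+1%:R ^+ 2 * ('C(h, n))%:R ^+ 2 *
  ((1 + p%:R * (x * c)) ^+ 2 * texp p (expU x n) (expV x n)).
  have -> : b + 1 = n.*2.+1%:R * (1 + p%:R * (x * c)).
    have -> : b + 1 = p%:R * x + n.*2.+1%:R by rewrite /b -[n.*2.+1%:R]natr1; ring.
    by rewrite /c; move: (n.*2.+1%:R) c0 => z z0; field.
  by ring.
have -> : (b + 2) ^+ 2 *
    (('C(h, n.+1))%:R ^+ 2 * texp p (expU x n.+1) (expV x n.+1)) =
  n.*2.+1%:R ^+ 2 * ('C(h, n))%:R ^+ 2 *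
  ((1 + p%:R * (x * d)) ^+ 2 * ((1 + p%:R * (- c)) ^+ 2 *
     texp p (expU x n.+1) (expV x n.+1))).
  have -> : b + 2 = n.*2.+2%:R * (1 + p%:R * (x * d)).
    have -> : b + 2 = p%:R * x + n.*2.+2%:R.
      by rewrite /b -[n.*2.+2%:R]natr1 -[n.*2.+1%:R]natr1; ring.
    by rewrite /d; move: (n.*2.+2%:R) d0 => z z0; field.
  rewrite binS_half // -/d.
  have -> : n.*2.+1%:R - p%:R = n.*2.+1%:R * (1 + p%:R * - c).
    by rewrite /c; move: (n.*2.+1%:R) c0 => z z0; field.
  have cancel (D C c' k e t d' : rat) : D * d' = 1 ->
      (D * e) ^+ 2 * ((- (C * (c' * k) * d')) ^+ 2 * t) =
      c' ^+ 2 * C ^+ 2 * (e ^+ 2 * (k ^+ 2 * t)).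
    move=> Dd; rewrite [LHS](_ : _ = (D * d') ^+ 2 *
      (c' ^+ 2 * C ^+ 2 * (e ^+ 2 * (k ^+ 2 * t)))); last by ring.
    by rewrite Dd expr1n mul1r.
  by apply: cancel; rewrite mulfV.
apply: eqZpMl => //; first by zp.
apply: (@eqZp_trans _ p_prime _ (texp p (2 * (x * c)) (- (2 * (x * c) ^+ 2)) *
    texp p (expU x n) (expV x n))).
  apply: eqZpMr => //; first exact: texp_Zp.
  by apply: sqr_texp => //; zp.
apply: (@eqZp_trans _ p_prime _ (texp p (2 * (x * c) + expU x n)
    (- (2 * (x * c) ^+ 2) + expV x n))).
  by apply: texpM => //; zp.
apply: eqZp_sym.
apply: (@eqZp_trans _ p_prime _ (texp p (2 * (x * d)) (- (2 * (x * d) ^+ 2)) *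
   (texp p (2 * (- c)) (- (2 * (- c) ^+ 2)) * texp p (expU x n.+1) (expV x n.+1)))).
  apply: eqZpM => //; first by apply: sqr_texp => //; zp.
  apply: eqZpMr => //; first exact: texp_Zp.
  by apply: sqr_texp => //; zp.
apply: (@eqZp_trans _ p_prime _ (texp p (2 * (x * d)) (- (2 * (x * d) ^+ 2)) *
   texp p (2 * (- c) + expU x n.+1) (- (2 * (- c) ^+ 2) + expV x n.+1))).
  apply: eqZpMl => //; first by apply: texp_Zp; zp.
  by apply: texpM => //; zp.
have -> : 2 * (x * c) + expU x n = 2 * (x * d) + (2 * (- c) + expU x n.+1).
  rewrite /expU doubleS !harmS -/c -/d.
  have -> : (n.+1%:R)^-1 = 2 * d :> rat.
    rewrite /d -doubleS -muln2 natrM; have : n.+1%:R != 0 :> rat by rewrite pnatr_eq0.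
    by move: (n.+1%:R) => z z0; field.
  by ring.
have -> : - (2 * (x * c) ^+ 2) + expV x n =
   - (2 * (x * d) ^+ 2) + (- (2 * (- c) ^+ 2) + expV x n.+1).
  rewrite /expV doubleS !harm2S -/c -/d.
  have -> : (n.+1%:R)^-1 = 2 * d :> rat.
    rewrite /d -doubleS -muln2 natrM; have : n.+1%:R != 0 :> rat by rewrite pnatr_eq0.
    by move: (n.+1%:R) => z z0; field.
  by field.
by apply: texpM; zp.
Qed.

(** The recurrence at a = p x - 1: since a + 1 = p x, the old sum contributes p^2 x^2 S(a) with S(a)
    congruent to 1. The closed form contributes p^2 times 2 * x * 1 * (1 / 2). *)
Lemma Ssum_pmul_add1 (x : rat) : x \in Zp_loc p ->
  eqZp p 3 (Ssum p (p%:R * x + 1)) (p%:R ^+ 2 * (x * (x + 1))).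
Proof.
move=> xZ; have F0 : p.-1`!%:R != 0 :> rat := fact_neq0 _.
have pm2 : p.-1 = (p - 2).+1 by move: p2; clear; lia.
have p2' := ltnW p2.
pose a := p%:R * x - 1.
have aZ : a \in Zp_loc p by rewrite /a; zp.
have b1 : eqZp p 1 (binq (a + p%:R) p) x.
  have -> : a + p%:R = p%:R * x + p.-1%:R by rewrite /a pE p1E -muln2 natrM; ring.
  by apply: binq_p_mod => //; rewrite prednK // prime_gt0.
have f1 : eqZp p 1 (ffq a (p - 2) / p.-1`!%:R) 1.
  have u1 : punit p (p%:R * (x - 1) + 1).
    apply: (@punit_eqZp _ p_prime _ 1); last exact: punit1.
    by apply: eqZp1_padd; zp.
  apply: (eqZp_mulIl p_prime u1).
  have -> : (p%:R * (x - 1) + 1) * (ffq a (p - 2) / p.-1`!%:R) = ffq a p.-1 / p.-1`!%:R.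
    rewrite {2}pm2 ffqSr natrB //.
    by rewrite /a; ring.
  apply: (@eqZp_trans _ p_prime _ 1).
    rewrite -[X in eqZp _ _ _ X](mulfV F0); apply: eqZpMr => //.
      by apply: punitV_Zp; apply: punit_fact_pred.
    exact: ffqN1_pred.
  by rewrite mulr1; apply: eqZp_sym; apply: eqZp1_padd; zp.
have s1 : eqZp p 1 (Ssum p a) 1.
  have -> : a = -1 - p%:R * - x by rewrite /a; ring.
  rewrite Ssum_sym; have [A [B [AZ BZ AB]]] := Ssum_pmul_quad.
  apply: (@eqZp_trans _ p_prime _ (1 + p%:R * A * - x + p%:R ^+ 2 * B * (- x) ^+ 2)).
    by apply: (@eqZp_le _ p_prime 3) => //; apply: AB; zp.
  by apply: (eqZp_padd p_prime (z := A * - x + p%:R * B * (- x) ^+ 2)); [zp|zp|ring].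
have u : punit p (p%:R * x + 1).
  apply: (@punit_eqZp _ p_prime _ 1); last exact: punit1.
  by apply: eqZp1_padd; zp.
apply: (eqZp_mulIl p_prime (punitX p_prime 2 u)).
have -> : (p%:R * x + 1) ^+ 2 * Ssum p (p%:R * x + 1) =
  p%:R ^+ 2 * (x ^+ 2 * Ssum p a +
   (4 * a + 6) * binq (a + p%:R) p * (ffq a (p - 2) / p.-1`!%:R) * cbin p).
  have -> : p%:R * x + 1 = a + 2 by rewrite /a; ring.
  rewrite -[LHS](subrK ((a + 1) ^+ 2 * Ssum p a)) Ssum_p_step2 //.
  by rewrite [(a + 1)](_ : _ = p%:R * x); [ring | rewrite /a; ring].
rewrite [X in eqZp _ _ _ X]mulrCA; apply: (@eqZp_pmul _ p_prime 2 1).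
apply: (@eqZp_trans _ p_prime _ (x ^+ 2 * 1 + 2 * x * 1 * (1 / 2))).
  apply: eqZpD => //; first by apply: eqZpMl => //; zp.
  apply: eqZpM => //; last exact: cbin_p_mod.
  apply: eqZpM => //; apply: eqZpM => //.
  by apply: (eqZp_padd p_prime (z := 4 * x)); [zp|zp|rewrite /a; ring].
apply: eqZp_sym.
apply: (eqZp_padd p_prime 
  (z := (2 * x + p%:R * x ^+ 2) * (x * (x + 1)))); [zp|zp|by field].
Qed.

(** With p^2 factored out, the recurrence is needed only modulo p, where b + 1 and b + 2 become 2n +
    2 and 2n + 3, and C(h, n + 1) (2n + 2) becomes - C(h, n) (2n + 1). *)
Lemma Ssum_odd (x : rat) (n : nat) : x \in Zp_loc p -> (n < h)%N ->
  eqZp p 3 (Ssum p (p%:R * x + n.*2.+1%:R))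
    (p%:R ^+ 2 * (x * (x + 1) / (n.*2.+1%:R ^+ 2 * ('C(h, n))%:R ^+ 2))).
Proof.
move=> xZ; elim: n => [|n IH] nh.
  by rewrite bin0 expr1n mul1r divr1; apply: Ssum_pmul_add1.
have n3p : (n.*2.+3 < p)%N by apply: ltnW; have := half_lt nh; rewrite doubleS.
have n2p := ltnW n3p; have n1p := ltnW n2p.
set b := p%:R * x + n.*2.+1%:R.
have bZ : b \in Zp_loc p by rewrite /b; zp.
have u1 : punit p n.*2.+1%:R by apply: punit_small.
have u2 : punit p n.*2.+2%:R by apply: punit_small.
have u3 : punit p n.*2.+3%:R by apply: punit_small.
have b1 : eqZp p 1 (b + 1) n.*2.+2%:R.
  have -> : b + 1 = p%:R * x + n.*2.+2%:R by rewrite /b -[n.*2.+2%:R]natr1; ring.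
  by apply: eqZp1_padd => //; zp.
have b2 : eqZp p 1 (b + 2) n.*2.+3%:R.
  have -> : b + 2 = p%:R * x + n.*2.+3%:R.
    by rewrite /b -[n.*2.+3%:R]natr1 -[n.*2.+2%:R]natr1; ring.
  by apply: eqZp1_padd => //; zp.
have -> : p%:R * x + (n.+1).*2.+1%:R = b + 2.
  by rewrite /b doubleS -[n.*2.+3%:R]natr1 -[n.*2.+2%:R]natr1; ring.
have bu : punit p (b + 2) := punit_eqZp p_prime b2 u3.
apply: (eqZp_mulIl p_prime (punitX p_prime 2 bu)).
have S2 : eqZp p 3 ((b + 2) ^+ 2 * Ssum p (b + 2)) ((b + 1) ^+ 2 * Ssum p b).
  exact: Ssum_step2_mod.
apply: (eqZp_trans p_prime S2).
have b1Z : (b + 1) ^+ 2 \in Zp_loc p by zp.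
apply: (eqZp_trans p_prime (eqZpMl p_prime b1Z (IH (ltnW nh)))).
rewrite mulrCA [X in eqZp _ _ _ X]mulrCA; apply: (@eqZp_pmul _ p_prime 2 1).
rewrite ![_ * (x * (x + 1) / _)]mulrCA; apply: eqZpMl => //; first by zp.
have Cu := punit_bin_half (ltnW (ltnW nh)); have Cu' := punit_bin_half (ltnW nh).
have Cb : eqZp p 1 (('C(h, n.+1))%:R * n.*2.+2%:R) (- (('C(h, n))%:R * n.*2.+1%:R)).
  rewrite (binS_half (ltnW nh)) mulNr divfK ?(punit_neq0 u2) //; apply: eqZpN => //.
  apply: eqZpMl => //; first by zp.
  have -> : n.*2.+1%:R - p%:R = p%:R * (-1) + n.*2.+1%:R :> rat by ring.
  by apply: eqZp1_padd; zp.
set W : rat := n.*2.+1%:R ^+ 2 * ('C(h, n))%:R ^+ 2.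
set W' : rat := (n.+1).*2.+1%:R ^+ 2 * ('C(h, n.+1))%:R ^+ 2.
have Wu : punit p W by apply: punitM => //; apply: punitX.
have Wu' : punit p W' by apply: punitM => //; apply: punitX => //; rewrite doubleS.
have W0 := punit_neq0 Wu; have W0' := punit_neq0 Wu'.
apply: (eqZp_mulIl p_prime (punitM p_prime Wu Wu')).
have -> : W * W' * ((b + 1) ^+ 2 / W) = (b + 1) ^+ 2 * W' by field.
have -> : W * W' * ((b + 2) ^+ 2 / W') = (b + 2) ^+ 2 * W by field.
apply: (@eqZp_trans _ p_prime _ (n.*2.+2%:R ^+ 2 * W')).
  by apply: eqZpMr; [by []|exact: punit_Zp|apply: eqZpX].
apply: eqZp_sym; apply: (@eqZp_trans _ p_prime _ (n.*2.+3%:R ^+ 2 * W)).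
  by apply: eqZpMr; [by []|exact: punit_Zp|apply: eqZpX].
have -> : n.*2.+2%:R ^+ 2 * W' =
    n.*2.+3%:R ^+ 2 * (('C(h, n.+1))%:R * n.*2.+2%:R) ^+ 2 by rewrite /W' doubleS; ring.
have -> : n.*2.+3%:R ^+ 2 * W =
    n.*2.+3%:R ^+ 2 * (- (('C(h, n))%:R * n.*2.+1%:R)) ^+ 2 by rewrite /W; ring.
apply: eqZpMl => //; first by zp.
by apply: eqZpX => //; apply: eqZp_sym.
Qed.

End Congruences.

(** * The weighted sum *)

Section WeightedSum.

Variables (p r : nat) (x : rat).
Hypothesis p_prime : prime p.
Hypothesis p_odd : odd p.
Hypothesis xZ : x \in Zp_loc p.
Hypothesis r_bounds : (0 < r < p.-1)%N.

Let p0 : p%:R != 0 :> rat.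
Proof. exact: primeR_neq0. Qed.

Let p2 : (2 < p)%N := odd_prime_gt2 p_odd p_prime.

Let pE : p%:R = p.-1%:R + 1 :> rat.
Proof. by rewrite natr1 prednK // prime_gt0. Qed.

Let a : rat := p%:R * x + r%:R.

(** The correction term of the theorem without its factor p^2. *)
Let rho : rat := x * (x + 1) / (a * (a + 1)).

Let aZ : a \in Zp_loc p.
Proof. by rewrite /a; zp. Qed.

Let punit_near (y : rat) (k : nat) : y \in Zp_loc p -> (0 < k < p)%N ->
  punit p (p%:R * y + k%:R).
Proof.
move=> yZ kp; apply: (@punit_eqZp _ p_prime _ k%:R); last exact: punit_small.
by apply: eqZp1_padd => //; zp.
Qed.

Let au : punit p a.
Proof. by apply: punit_near => //; nat_lia. Qed.

Let a1u : punit p (a + 1).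
Proof. by rewrite /a -addrA natr1; apply: punit_near => //; nat_lia. Qed.

Let apu : punit p (a + p%:R).
Proof.
have -> : a + p%:R = p%:R * (x + 1) + r%:R by rewrite /a; ring.
by apply: punit_near; [zp | nat_lia].
Qed.

Let a1pu : punit p (a + 1 - p%:R).
Proof.
have -> : a + 1 - p%:R = p%:R * (x - 1) + r.+1%:R by rewrite /a -[r.+1%:R]natr1; ring.
by apply: punit_near; [zp | nat_lia].
Qed.

Let tp_mod : eqZp p 1 (summand a p) (- (x * (x + 1) / 2)).
Proof. by apply: summand_p_mod => //; nat_lia. Qed.

Let rho_Zp : rho \in Zp_loc p.
Proof. by rewrite /rho; zp; apply: punitV_Zp; apply: punitM. Qed.

(** [summandS] expresses the term at p - 1 as 2 p^3 [summand a p] over a unit; dividing by k + 1 = p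
    leaves p^2, and [summand a p] is known modulo p. *)
Lemma last_term_mod :
  eqZp p 3 (summand a p.-1 / p%:R) (p%:R ^+ 2 * - rho).
Proof.
have u1 : punit p (1 - 2 * p%:R).
  apply: (@punit_eqZp _ p_prime _ 1); last exact: punit1.
  by apply: (eqZp_padd p_prime (z := -2)); [zp | zp | ring].
have n1 := punit_neq0 u1; have n2 := punit_neq0 apu; have n3 := punit_neq0 a1pu.
have -> : summand a p.-1 / p%:R =
  p%:R ^+ 2 * (2 * summand a p / ((a + 1 - p%:R) * (a + p%:R) * (1 - 2 * p%:R))).
  have := summandS a p.-1; rewrite prednK ?prime_gt0 // => ->.
  have -> : a + p.-1%:R + 1 = a + p%:R by rewrite pE; ring.
  have -> : a - p.-1%:R = a + 1 - p%:R by rewrite pE; ring.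
  have -> : 2 * p.-1%:R + 1 = - (1 - 2 * p%:R) :> rat by rewrite pE; ring.
  by field; rewrite p0 n1 n2 n3.
apply: (@eqZp_pmul _ p_prime 2 1).
have U := punitM p_prime (punitM p_prime a1pu apu) u1.
apply: (eqZp_mulIl p_prime U); rewrite mulrC divfK ?(punit_neq0 U) //.
apply: (@eqZp_trans _ p_prime _ (2 * - (x * (x + 1) / 2))).
  by apply: eqZpMl => //; zp.
have -> : 2 * - (x * (x + 1) / 2) = (a + 1) * a * 1 * - rho.
  by rewrite /rho; field; rewrite (punit_neq0 au) (punit_neq0 a1u).
apply: eqZp_sym; apply: eqZpMr => //; first exact: ZpN.
apply: eqZpM => //; first apply: eqZpM => //.
- by apply: (eqZp_padd p_prime (z := -1)); [zp | zp | ring].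
- by apply: (eqZp_padd p_prime (z := 1)); [zp | zp | ring].
by apply: (eqZp_padd p_prime (z := -2)); [zp | zp | ring].
Qed.

(** In [sum_summand_div] at n = p - 1 the run of 2p - 1 factors lacks only a + 1 - p from that of
    [summand a p], so the remainder is p^2 [summand a p] times an element of the localization. *)
Lemma full_sum_mod :
  eqZp p 3 (\sum_(0 <= k < p) summand a k / k.+1%:R)
    (Ssum p a + (a + 1) / a * Ssum p (a + 1) + p%:R ^+ 2 * - rho).
Proof.
have a0 := punit_neq0 au; have n3 := punit_neq0 a1pu.
have F0 : p.-1`!%:R != 0 :> rat := fact_neq0 _.
have := sum_summand_div p.-1 a; rewrite prednK ?prime_gt0 // => E.
have -> : \sum_(0 <= k < p) summand a k / k.+1%:R =
    Ssum p a + (a + 1) / a * Ssum p (a + 1) +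
    p%:R ^+ 2 * (2 * summand a p / (a * (a + 1 - p%:R))).
  have tE : summand a p = - (ffq (a + p%:R) (p.-1 + p.-1).+1 * (a + 1 - p%:R))
      / (p%:R * p.-1`!%:R) ^+ 2 * cbin p.
    rewrite summandE (_ : (p + p)%N = (p.-1 + p.-1).+2); last by clear -p2; lia.
    rewrite ffqSr -natrM.
    have -> : (p * (p.-1)`!)%N = p`!.
      by rewrite -{1}(prednK (prime_gt0 p_prime)) -factS prednK // prime_gt0.
    rewrite -signr_odd p_odd expr1 -[(p.-1 + p.-1).+1%:R]natr1 natrD.
    have -> : a + p%:R - (p.-1%:R + p.-1%:R + 1) = a + 1 - p%:R by rewrite pE; ring.
    by ring.
  rewrite sign_pred // in E.
  apply: (mulfI a0).
  rewrite -[LHS](subrK (a * Ssum p a)).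
  rewrite -[X in X + _ = _](subrK ((a + 1) * Ssum p (a + 1))).
  rewrite E tE.
  by field; rewrite p0 a0 n3 F0.
have SZ := Ssum_Zp p_prime p_odd aZ.
have a1Z := punit_Zp a1u.
have SZ' := Ssum_Zp p_prime p_odd a1Z.
have aVZ := punitV_Zp au.
apply: eqZpD => //; first by apply: eqZp_refl; zp.
apply: (@eqZp_pmul _ p_prime 2 1).
have U := punitM p_prime au a1pu.
apply: (eqZp_mulIl p_prime U); rewrite mulrC divfK ?(punit_neq0 U) //.
apply: (@eqZp_trans _ p_prime _ (2 * - (x * (x + 1) / 2))).
  by apply: eqZpMl => //; zp.
have -> : 2 * - (x * (x + 1) / 2) = a * (a + 1) * - rho.
  by rewrite /rho; field; rewrite (punit_neq0 au) (punit_neq0 a1u).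
apply: eqZp_sym; apply: eqZpMr => //; first exact: ZpN.
apply: eqZpMl => //.
by apply: (eqZp_padd p_prime (z := -1)); [zp | zp | ring].
Qed.

Lemma short_sum_Zp : \sum_(0 <= k < p.-1) summand a k / k.+1%:R \in Zp_loc p.
Proof.
rewrite big_mkord; apply: Zp_sum => // i _; have := ltn_ord i => ip.
apply: ZpM => //; first by apply: summand_Zp => //; nat_lia.
by apply: punitV_Zp; apply: punit_small => //; nat_lia.
Qed.

Let full_sumE : \sum_(0 <= k < p) summand a k / k.+1%:R =
  \sum_(0 <= k < p.-1) summand a k / k.+1%:R + summand a p.-1 / p%:R.
Proof.
by rewrite -{1}(prednK (prime_gt0 p_prime)) big_nat_recr // prednK // prime_gt0.
Qed.

Lemma full_short_sum_mod :
  eqZp p 3 (\sum_(0 <= k < p) summand a k / k.+1%:R + p%:R ^+ 2 * rho)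
    (\sum_(0 <= k < p.-1) summand a k / k.+1%:R).
Proof.
rewrite full_sumE -addrA -[X in eqZp _ _ _ X]addr0; apply: eqZpD => //.
  by apply: eqZp_refl; rewrite ?short_sum_Zp.
have -> : 0 = p%:R ^+ 2 * - rho + p%:R ^+ 2 * rho by ring.
apply: eqZpD => //; first exact: last_term_mod.
by apply: eqZp_refl; zp.
Qed.

(** The correction - p^2 [rho] of the full sum is exactly its last term modulo p^3, so the two
    cancel. *)
Lemma short_sum_mod :
  eqZp p 3 (\sum_(0 <= k < p.-1) summand a k / k.+1%:R)
    (Ssum p a + (a + 1) / a * Ssum p (a + 1)).
Proof.
apply: (eqZp_trans p_prime (eqZp_sym full_short_sum_mod)).
have -> : Ssum p a + (a + 1) / a * Ssum p (a + 1) =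
  (Ssum p a + (a + 1) / a * Ssum p (a + 1) + p%:R ^+ 2 * - rho) +
  p%:R ^+ 2 * rho by ring.
apply: eqZpD => //; first exact: full_sum_mod.
by apply: eqZp_refl; zp.
Qed.

End WeightedSum.

(** * Assembly according to the parity of the residue *)

Theorem theorem3p1 (p : nat) (p_prime : prime p) (p_odd : odd p)
    (a : rat) (aZp : a \in Zp_loc p)
    (a_neq0 : ~~ eqZp p 1 a 0) (a_neqN1 : ~~ eqZp p 1 a (-1)) :
  let m := residue p a in
  let a' := (a - m%:R) / p%:R in
  let q := fermat_quot2 p in
  let P := p%:R : rat in
  [/\ eqZp p 3
        (\sum_(0 <= k < p) summand a k / k.+1%:R
           + a' * (a' + 1) / (a * (a + 1)) * P ^+ 2)
        (\sum_(0 <= k < p.-1) summand a k / k.+1%:R),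
      eqZp p 3
        (\sum_(0 <= k < p.-1) summand a k / k.+1%:R)
        (Ssum p a + (a + 1) / a * Ssum p (a + 1)),
      ~~ odd m ->
      eqZp p 3
        (\sum_(0 <= k < p.-1) summand a k / k.+1%:R)
        (('C(p.-1./2, m./2))%:R ^+ 2 *
           (1 + P * ((2 * a' + 2) * harm m - (2 * a' + 1) * harm m./2 - 2 * a' * q)
              + P ^+ 2 / 2 *
                (2 * a' * q ^+ 2
                 + ((2 * a' + 2) * harm m - (2 * a' + 1) * harm m./2
                      - 2 * a' * q) ^+ 2
                 + 1 / 2 * (2 * a' ^+ 2 - 1) * harm2 m./2
                 + 2 * (1 - a' ^+ 2) * harm2 m))
         + P ^+ 2 * (a' * (a' + 1) / (a * (a + 1)))
             * ('C(p.-1./2, m./2))%:R ^- 2)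
    & odd m -> m <> (p - 2)%N ->
      eqZp p 3
        (\sum_(0 <= k < p.-1) summand a k / k.+1%:R)
        ((a + 1) / a * ('C(p.-1./2, m.+1./2))%:R ^+ 2 *
           (1 + P * ((2 * a' + 2) * harm m.+1 - (2 * a' + 1) * harm m.+1./2
                       - 2 * a' * q)
              + P ^+ 2 / 2 *
                (2 * a' * q ^+ 2
                 + ((2 * a' + 2) * harm m.+1 - (2 * a' + 1) * harm m.+1./2
                      - 2 * a' * q) ^+ 2
                 + 1 / 2 * (2 * a' ^+ 2 - 1) * harm2 m.+1./2
                 + 2 * (1 - a' ^+ 2) * harm2 m.+1))
         + P ^+ 2 * (a' * (a' + 1) / (a + 1) ^+ 2)
             * ('C(p.-1./2, m.+1./2))%:R ^- 2)].
Proof.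
move=> m a' q P.
have /andP[mp /and3P[_ _ a'Z]] := residueP p_prime aZp.
rewrite -/m expr1 -/a' in a'Z.
have p2 := odd_prime_gt2 p_odd p_prime.
have p0 : P != 0 := primeR_neq0 p_prime.
have aE : a = P * a' + m%:R by rewrite /a' /P; field.
have am : eqZp p 1 a m%:R by rewrite aE; apply: eqZp1_padd => //; zp.
have m0 : (0 < m)%N.
  by rewrite lt0n; apply: contraNneq a_neq0 => m0; rewrite m0 in am.
have mp1 : (m < p.-1)%N.
  have : m != p.-1; last by nat_lia.
  apply: contraNneq a_neqN1 => mE; apply: (eqZp_trans p_prime am).
  apply: (eqZp_padd p_prime (z := 1)); [by zp | by zp |].
  by rewrite mE expr1 mulr1 -{2}(prednK (prime_gt0 p_prime)) -natr1; ring.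
have mb : (0 < m < p.-1)%N by rewrite m0.
have T1 := full_short_sum_mod p_prime p_odd a'Z mb; rewrite -/P -aE in T1.
have T2 := short_sum_mod p_prime p_odd a'Z mb; rewrite -/P -aE in T2.
have au : punit p a by apply: (punit_neqZp0 p_prime).
have a1 : eqZp p 1 (a + 1) m.+1%:R.
  by rewrite -natr1; apply: eqZpD => //; apply: eqZp_refl => //; zp.
have a1u : punit p (a + 1).
  by apply: (punit_eqZp p_prime a1); apply: punit_small => //; nat_lia.
have n1 := punit_neq0 au; have n2 := punit_neq0 a1u.
have cZ : (a + 1) / a \in Zp_loc p.
  by apply: ZpM => //; [exact: punit_Zp | exact: punitV_Zp].
have hE := odd_predE p_odd.
split=> [||mev|mod mp2].
- by rewrite [_ / _ * P ^+ 2]mulrC.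
- exact: T2.
(* For m = 2n, S(a) gives the main part through [Ssum_even] and S(a + 1), of residue 2n + 1, the p^2
   term through [Ssum_odd]. *)
- have mE : m = m./2.*2 by have := odd_double_half m; nat_lia.
  move: (m./2) mE => n mE.
  apply: (eqZp_trans p_prime T2); apply: eqZpD => //.
    have nh : (n <= p.-1./2)%N by nat_lia.
    have p3 : (3 < p)%N by nat_lia.
    rewrite [X in eqZp _ _ _ (_ * X)](_ : _ = texp p (expU p a' n) (expV p a' n)).
      rewrite [in Ssum p a]aE mE; exact: Ssum_even.
    by rewrite /texp /expU /expV -mE -/P -/q; ring.
  have nh : (n < p.-1./2)%N by nat_lia.
  have Cu := punit_bin_half p_prime p_odd (ltnW nh).
  have C0 := punit_neq0 Cu.
  have := Ssum_odd p_prime p_odd a'Z nh.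
  rewrite -/P -[n.*2.+1%:R]natr1 -{1}mE addrA -aE natr1 => S1.
  apply: (eqZp_trans p_prime (eqZpMl p_prime cZ S1)).
  have nu : punit p n.*2.+1%:R by apply: punit_small => //; nat_lia.
  have n3 := punit_neq0 nu.
  rewrite mulrCA -[X in eqZp _ _ _ X]mulrA; apply: (@eqZp_pmul _ p_prime 2 1).
  (* Clearing denominators with this unit reduces the claim to (a + 1)^2 being congruent to (m +
     1)^2 modulo p. *)
  have W := punitM p_prime (punitX p_prime 2 nu)
    (punitM p_prime (punitM p_prime au a1u) (punitX p_prime 2 Cu)).
  apply: (eqZp_mulIl p_prime W).
  have id1 (u s N C : rat) : u != 0 -> N != 0 -> C != 0 ->
      N ^+ 2 * (u * (u + 1) * C ^+ 2) * ((u + 1) / u * (s / (N ^+ 2 * C ^+ 2))) =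
      s * (u + 1) ^+ 2.
    by move=> u0 N0 K0; field; rewrite u0 N0 K0.
  have id2 (u s N C : rat) : u != 0 -> u + 1 != 0 -> C != 0 ->
      N ^+ 2 * (u * (u + 1) * C ^+ 2) * (s / (u * (u + 1)) / C ^+ 2) = s * N ^+ 2.
    by move=> u0 u1 K0; field; rewrite u0 u1 K0.
  rewrite id1 // id2 //.
  by apply: eqZpMl => //; [zp | apply: eqZpX => //; rewrite -mE].
(* The roles are exchanged: S(a + 1), of even residue 2(n + 1), gives the main part and S(a) the p^2
   term. From m <> p - 2 follows n + 1 < (p - 1) / 2. *)
have mE : m.+1 = m.+1./2.*2 by have := odd_double_half m.+1; rewrite /= mod; nat_lia.
have [n nE] : exists n, m.+1./2 = n.+1 by exists (m.+1./2).-1; nat_lia.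
rewrite nE {nE} in mE *; rewrite mE.
have nh : (n.+1 < p.-1./2)%N by nat_lia.
have p3 : (3 < p)%N by nat_lia.
have Cu := punit_bin_half p_prime p_odd (ltnW (ltnW nh)).
have Cu' := punit_bin_half p_prime p_odd (ltnW nh).
have C0 := punit_neq0 Cu; have C0' := punit_neq0 Cu'.
have mE' : m = n.*2.+1 by nat_lia.
apply: (eqZp_trans p_prime T2); rewrite addrC; apply: eqZpD => //.
  rewrite -[X in eqZp _ _ _ X]mulrA; apply: eqZpMl => //.
  rewrite [X in eqZp _ _ _ (_ * X)](_ : _ = texp p (expU p a' n.+1) (expV p a' n.+1)).
    have -> : a + 1 = P * a' + n.+1.*2%:R by rewrite -mE -natr1 addrA -aE.
    exact: Ssum_even (ltnW nh).
  by rewrite /texp /expU /expV -/P -/q; ring.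
have := Ssum_odd p_prime p_odd a'Z (ltnW nh); rewrite -/P -mE' -aE => S1.
apply: (eqZp_trans p_prime S1).
rewrite -[X in eqZp _ _ _ X]mulrA; apply: (@eqZp_pmul _ p_prime 2 1).
have mu : punit p m%:R by apply: punit_small => //; nat_lia.
have nu : punit p m.+1%:R by apply: punit_small => //; nat_lia.
have W := punitM p_prime (punitM p_prime (punitX p_prime 2 mu) (punitX p_prime 2 a1u))
  (punitM p_prime (punitX p_prime 2 Cu) (punitX p_prime 2 Cu')).
apply: (eqZp_mulIl p_prime W).
have n3 := punit_neq0 mu.
(* [Ssum_odd] yields C(h, n) while the claim has C(h, n + 1); this converts one into the other, and
   the sign disappears on squaring. *)
have Cb : eqZp p 1 (('C(p.-1./2, n.+1))%:R * m.+1%:R) (- (('C(p.-1./2, n))%:R * m%:R)).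
  rewrite (binS_half p_prime p_odd) ?(ltnW nh) // mE -doubleS mulNr divfK ?pnatr_eq0 //.
  apply: eqZpN => //; apply: eqZpMl => //; first by zp.
  rewrite -mE'; have -> : m%:R - p%:R = p%:R * (-1) + m%:R :> rat by ring.
  by apply: eqZp1_padd; zp.
have id1 (u s N C C' : rat) : N != 0 -> C != 0 ->
    N ^+ 2 * u ^+ 2 * (C ^+ 2 * C' ^+ 2) * (s / (N ^+ 2 * C ^+ 2)) =
    s * (C' * u) ^+ 2.
  by move=> N0 K0; field; rewrite N0 K0.
have id2 (u s N C C' : rat) : u != 0 -> C' != 0 ->
    N ^+ 2 * u ^+ 2 * (C ^+ 2 * C' ^+ 2) * (s / u ^+ 2 / C' ^+ 2) =
    s * (- (C * N)) ^+ 2.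
  by move=> u0 K0; field; rewrite u0 K0.
rewrite id1 // id2 //.
apply: eqZpMl => //; first by zp.
apply: eqZpX => //.
apply: (@eqZp_trans _ p_prime _ (('C(p.-1./2, n.+1))%:R * m.+1%:R)) => //.
by apply: eqZpMl => //; apply: punit_Zp.
Qed.
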